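(* Let $r_0>0$ and $0<L_0\le1$ be constants, let $\xi=\xi(r)$ and $h=h(\theta)$ be everywhere non-vanishing smooth functions, and let $g$ be the charged Nariai type metric $$ds^2=\frac{r_0^2}{L_0}\left(-\xi^2(r)\,dt^2+dr^2\right)+r_0^2\left(d\theta^2+h^2(\theta)\,d\phi^2\right)$$ in coordinates $(t,r,\theta,\phi)$. Then $g$ is: (i) semisymmetric and pseudosymmetric due to the conformal curvature tensor; (ii) a $2$-quasi-Einstein, generalized quasi-Einstein and Roter type manifold; (iii) a special $SGK_4$ and a $P$-$SGK_4$ manifold; (iv) a $C$-$K_4$ and a special $W$-$SGK_4$ manifold; (v) Riemann compatible as well as projective compatible, i.e. its Ricci tensor $S$ is $R$-compatible and $P$-compatible.
   Context: Conventions ($n=4$; $\nabla$ is the Levi-Civita connection). $R_{pqrs}$ is the Riemann curvature tensor, with the sign and index convention $R_{pqrs}=g(\mathcal R(\partial_p,\partial_q)\partial_s,\partial_r)$, where $\mathcal R(X,Y)Z=\nabla_X\nabla_YZ-\nabla_Y\nabla_XZ-\nabla_{[X,Y]}Z$; $S_{qr}=g^{ps}R_{pqrs}$ is the Ricci tensor, $\kappa=g^{qr}S_{qr}$, $S^t_p=g^{ts}S_{sp}$. Define $C_{pqrs}=R_{pqrs}-\frac{1}{n-2}(g_{ps}S_{qr}-g_{qs}S_{pr}+S_{ps}g_{qr}-S_{qs}g_{pr})+\frac{\kappa}{(n-1)(n-2)}(g_{ps}g_{qr}-g_{qs}g_{pr})$ (conformal curvature), $P_{pqrs}=R_{pqrs}-\frac{1}{n-1}(g_{ps}S_{qr}-g_{qs}S_{pr})$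 (projective), $W_{pqrs}=R_{pqrs}-\frac{\kappa}{n(n-1)}(g_{ps}g_{qr}-g_{qs}g_{pr})$ (concircular). For a $(0,4)$-tensor $U$, a symmetric $(0,2)$-tensor $Z$ and a $(0,k)$-tensor $T$: $(U\cdot T)_{p_1\dots p_krs}=-g^{\alpha\beta}[U_{rsp_1\beta}T_{\alpha p_2\dots p_k}+\cdots+U_{rsp_k\beta}T_{p_1\dots p_{k-1}\alpha}]$, $Q(Z,T)_{p_1\dots p_krs}=Z_{sp_1}T_{rp_2\dots p_k}+\cdots+Z_{sp_k}T_{p_1\dots p_{k-1}r}-Z_{rp_1}T_{sp_2\dots p_k}-\cdots-Z_{rp_k}T_{p_1\dots p_{k-1}s}$. Kulkarni–Nomizu product: $(E\wedge A)_{pqrs}=E_{ps}A_{qr}-E_{pr}A_{qs}+E_{qr}A_{ps}-E_{qs}A_{pr}$. Definitions. Semisymmetric: $R\cdot R=0$. Pseudosymmetric due to the conformal curvature tensor: $C\cdot R=\mathcal J\,Q(g,R)$, where $\mathcal J$ is some scalar function on the set where $Q(g,R)\neq0$. $2$-quasi-Einstein: the rank of $S-\alpha g$ is $2$ for some scalar $\alpha$. Generalized quasi-Einstein (in the sense of Chaki): $S=\alpha g+\beta\,\eta\otimes\eta+\gamma(\eta\otimes\delta+\delta\otimes\eta)$ for some scalars $\alpha,\beta,\gamma$ and $1$-forms $\eta,\delta$. Roter type: $R=\mu_1\,g\wedge g+\mu_2\,g\wedge S+\mu_3\,S\wedge S$ for some scalars $\mu_i$. For a $(0,4)$-tensor $T$,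 the manifold is $T$-$SGK_n$ ($T$-super generalized recurrent) if $$\nabla_\alpha T_{pqrs}=\Pi_\alpha T_{pqrs}+\Phi_\alpha(S\wedge S)_{pqrs}+\Psi_\alpha(g\wedge S)_{pqrs}+\Theta_\alpha(g\wedge g)_{pqrs}$$ for some $1$-forms $\Pi,\Phi,\Psi,\Theta$; it is special $T$-$SGK_n$ if this holds with $\Psi=0$; it is $T$-$K_n$ ($T$-recurrent) if this holds with $\Phi=\Psi=\Theta=0$. For $T=R$ the prefix $T$ is dropped. $S$ is $B$-compatible, for a $(0,4)$-tensor $B$, if $S^t_pB_{qrst}+S^t_qB_{rpst}+S^t_rB_{pqst}=0$.
   Formalization: As literally stated it fails (e.g. ξ=h=1), so 2-quasi-Einstein and Roter are claimed where S≠(κ/4)g, the SGK claims where rank of S−(κ/4)g (and of S, for the special ones) is locally constant, and C-K4 where vanishing of C is locally constant. *)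

(* Defs.v *)
From mathcomp Require Import all_boot all_order all_algebra.
From mathcomp Require Import all_classical all_reals all_analysis.
Import Order.TTheory GRing.Theory Num.Theory.
Import numFieldNormedType.Exports.
Set Implicit Arguments.
Unset Strict Implicit.
Unset Printing Implicit Defensive.
Local Open Scope classical_set_scope.
Local Open Scope ring_scope.

(* The metric lives in one coordinate chart: a field on the 4-manifold is a
   total function on 'rV[R]_4, and only its values on the chart (an open set)
   matter. *)

Definition smooth_on1 (R : realType) (I : set R) (f : R -> R) : Prop :=
  forall (k : nat) (x : R), I x -> derivable (derive1n k f) x 1.

Section Fields.
Variable R : realType.
Local Notation point := 'rV[R]_4.

Definition partial (i : 'I_4) (f : point -> R) : point -> R :=
  fun x => 'D_(delta_mx 0 i : point) f x.

(* C^oo: every iterated partial derivative is (Frechet) differentiable. *)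
Definition smooth_on (U : set point) (f : point -> R) : Prop :=
  forall (s : seq 'I_4) (x : point), U x -> differentiable (foldr partial f s) x.

Definition tensor4 := 'I_4 -> 'I_4 -> 'I_4 -> 'I_4 -> R.
Definition tensor6 := 'I_4 -> 'I_4 -> 'I_4 -> 'I_4 -> 'I_4 -> 'I_4 -> R.
Definition one_form := point -> 'rV[R]_4.

Definition smooth_form (U : set point) (w : one_form) : Prop :=
  forall i : 'I_4, smooth_on U (fun x => w x 0 i).

(* [g] is given by its matrix of components; [invmx (g x)] is g^{ij}. *)
Variable g : point -> 'M[R]_4.

Definition christoffel (k i j : 'I_4) : point -> R := fun x =>
  2^-1 * \sum_l invmx (g x) k l *
    (partial i (fun y => g y j l) x + partial j (fun y => g y i l) x
     - partial l (fun y => g y i j) x).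

(* [curvature_op t p q s] is the [t] component of R(d_p, d_q) d_s. *)
Definition curvature_op (t p q s : 'I_4) : point -> R := fun x =>
  partial p (christoffel t q s) x - partial q (christoffel t p s) x
  + \sum_u (christoffel t p u x * christoffel u q s x
            - christoffel t q u x * christoffel u p s x).

(* R_{pqrs} = g(R(d_p, d_q) d_s, d_r), so that with S_{qr} = g^{ps} R_{pqrs}
   the unit round sphere has negative Ricci tensor. *)
Definition riemann (x : point) : tensor4 := fun p q r s =>
  \sum_t g x r t * curvature_op t p q s x.

Definition ricci (x : point) : 'M[R]_4 :=
  \matrix_(q, r) \sum_p \sum_s invmx (g x) p s * riemann x p q r s.

Definition scalar_curvature (x : point) : R :=
  \sum_q \sum_r invmx (g x) q r * ricci x q r.

(* S^t_p = g^{ts} S_{sp} *)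
Definition ricci_up (x : point) : 'M[R]_4 := invmx (g x) *m ricci x.

Local Notation n := (4 : R).

Definition conformal (x : point) : tensor4 := fun p q r s =>
  let G := g x in let S := ricci x in let kappa := scalar_curvature x in
  riemann x p q r s
  - (n - 2)^-1 * (G p s * S q r - G q s * S p r + S p s * G q r - S q s * G p r)
  + kappa / ((n - 1) * (n - 2)) * (G p s * G q r - G q s * G p r).

Definition projective (x : point) : tensor4 := fun p q r s =>
  let G := g x in let S := ricci x in
  riemann x p q r s - (n - 1)^-1 * (G p s * S q r - G q s * S p r).

Definition concircular (x : point) : tensor4 := fun p q r s =>
  let G := g x in let kappa := scalar_curvature x in
  riemann x p q r s - kappa / (n * (n - 1)) * (G p s * G q r - G q s * G p r).

(* The operations U . T and Q(Z, T), for T of type (0,4). *)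
Definition tdot (x : point) (U T : tensor4) : tensor6 :=
  fun p1 p2 p3 p4 r s =>
  - \sum_a \sum_b invmx (g x) a b *
      (U r s p1 b * T a p2 p3 p4 + U r s p2 b * T p1 a p3 p4
       + U r s p3 b * T p1 p2 a p4 + U r s p4 b * T p1 p2 p3 a).

Definition tachibana (Z : 'M[R]_4) (T : tensor4) : tensor6 :=
  fun p1 p2 p3 p4 r s =>
  Z s p1 * T r p2 p3 p4 + Z s p2 * T p1 r p3 p4
  + Z s p3 * T p1 p2 r p4 + Z s p4 * T p1 p2 p3 r
  - Z r p1 * T s p2 p3 p4 - Z r p2 * T p1 s p3 p4
  - Z r p3 * T p1 p2 s p4 - Z r p4 * T p1 p2 p3 s.

Definition kulkarni_nomizu (E A : 'M[R]_4) : tensor4 := fun p q r s =>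
  E p s * A q r - E p r * A q s + E q r * A p s - E q s * A p r.

(* [nabla T x a p q r s] is the (a, p, q, r, s) component of the covariant
   derivative of T, the first index being the direction. *)
Definition nabla (T : point -> tensor4) (x : point) (a p q r s : 'I_4) : R :=
  partial a (fun y => T y p q r s) x
  - \sum_t (christoffel t a p x * T x t q r s + christoffel t a q x * T x p t r s
            + christoffel t a r x * T x p q t s + christoffel t a s x * T x p q r t).

(* In what follows U is the set of points on which the property is asserted. *)

Definition semisymmetric (U : set point) : Prop :=
  forall x, U x -> forall p1 p2 p3 p4 r s,
    tdot x (riemann x) (riemann x) p1 p2 p3 p4 r s = 0.

(* J is only meaningful where Q(g, R) <> 0; elsewhere the equation says that
   C . R vanishes. *)
Definition conformally_pseudosymmetric (U : set point) : Prop :=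
  exists J : point -> R,
    smooth_on
      [set x | U x /\ exists p1 p2 p3 p4 r s,
                 tachibana (g x) (riemann x) p1 p2 p3 p4 r s != 0] J /\
    forall x, U x -> forall p1 p2 p3 p4 r s,
      tdot x (conformal x) (riemann x) p1 p2 p3 p4 r s
      = J x * tachibana (g x) (riemann x) p1 p2 p3 p4 r s.

Definition two_quasi_einstein (U : set point) : Prop :=
  exists alpha : point -> R, smooth_on U alpha /\
    forall x, U x -> \rank (ricci x - alpha x *: g x) = 2%N.

Definition generalized_quasi_einstein (U : set point) : Prop :=
  exists (alpha beta gamma : point -> R) (eta delta : one_form),
    [/\ smooth_on U alpha, smooth_on U beta & smooth_on U gamma] /\
    (smooth_form U eta /\ smooth_form U delta) /\
    forall x, U x -> forall i j,
      ricci x i j = alpha x * g x i j + beta x * (eta x 0 i * eta x 0 j)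
        + gamma x * (eta x 0 i * delta x 0 j + delta x 0 i * eta x 0 j).

Definition roter_type (U : set point) : Prop :=
  exists mu1 mu2 mu3 : point -> R,
    [/\ smooth_on U mu1, smooth_on U mu2 & smooth_on U mu3] /\
    forall x, U x -> forall p q r s,
      riemann x p q r s
      = mu1 x * kulkarni_nomizu (g x) (g x) p q r s
        + mu2 x * kulkarni_nomizu (g x) (ricci x) p q r s
        + mu3 x * kulkarni_nomizu (ricci x) (ricci x) p q r s.

Definition sgk_with (T : point -> tensor4) (U : set point)
    (Pi Phi Psi Theta : one_form) : Prop :=
  [/\ smooth_form U Pi, smooth_form U Phi, smooth_form U Psi
    & smooth_form U Theta] /\
  forall x, U x -> forall a p q r s,
    nabla T x a p q r s
    = Pi x 0 a * T x p q r s
      + Phi x 0 a * kulkarni_nomizu (ricci x) (ricci x) p q r s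
      + Psi x 0 a * kulkarni_nomizu (g x) (ricci x) p q r s
      + Theta x 0 a * kulkarni_nomizu (g x) (g x) p q r s.

Definition super_generalized_recurrent (T : point -> tensor4) (U : set point) :=
  exists Pi Phi Psi Theta, sgk_with T U Pi Phi Psi Theta.

Definition special_super_generalized_recurrent
    (T : point -> tensor4) (U : set point) :=
  exists Pi Phi Theta, sgk_with T U Pi Phi (fun=> 0) Theta.

Definition recurrent (T : point -> tensor4) (U : set point) :=
  exists Pi, sgk_with T U Pi (fun=> 0) (fun=> 0) (fun=> 0).

Definition ricci_compatible (B : point -> tensor4) (U : set point) : Prop :=
  forall x, U x -> forall p q r s,
    \sum_t (ricci_up x t p * B x q r s t + ricci_up x t q * B x r p s t
            + ricci_up x t r * B x p q s t) = 0.

(* Domains.  Some of these properties can only be asked away from degenerate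
   points: S - alpha g has rank 0 or 4, never 2, where S = (kappa / 4) g, and
   nabla C = Pi C forces nabla C = 0 wherever C = 0.  Likewise the 1-forms of
   the super generalized recurrent conditions are obtained by dividing by
   eigenvalues of S and by their differences, so they exist near a point only
   if the number of such vanishing quantities does not jump there. *)

Definition tracefree_ricci (x : point) : 'M[R]_4 :=
  ricci x - (scalar_curvature x / n) *: g x.

(* The usual set U_S of points where S is not proportional to g. *)
Definition non_einstein (D : set point) : set point :=
  [set x | D x /\ tracefree_ricci x != 0].

(* The points of D near which [f] is constant: an open set.  It is dense in D
   when [f] is the rank of a continuous matrix or the nullity of a continuous
   tensor, by semicontinuity. *)
Definition locally_constant_part (T : Type) (D : set point) (f : point -> T) :
  set point := [set x | D x /\ \forall y \near x, f y = f x].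

Definition tracefree_regular (D : set point) : set point :=
  locally_constant_part D (fun x => \rank (tracefree_ricci x)).

Definition ricci_regular (D : set point) : set point :=
  tracefree_regular D `&` locally_constant_part D (fun x => \rank (ricci x)).

Definition conformal_regular (D : set point) : set point :=
  locally_constant_part D (fun x => `[< forall p q r s, conformal x p q r s = 0 >]).

End Fields.

Section Nariai.
Variable R : realType.

Definition ir : 'I_4 := @Ordinal 4 1 isT.
Definition itheta : 'I_4 := @Ordinal 4 2 isT.

(* Coordinates (t, r, theta, phi) have indices 0, 1, 2, 3. *)
Definition nariai_metric (r0 L0 : R) (xi h : R -> R) (x : 'rV[R]_4) : 'M[R]_4 :=
  diag_mx (\row_(i < 4) nth 0
    [:: - (r0 ^+ 2 / L0 * xi (x 0 ir) ^+ 2);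
        r0 ^+ 2 / L0;
        r0 ^+ 2;
        r0 ^+ 2 * h (x 0 itheta) ^+ 2] i).

Definition nariai_chart (I J : set R) : set 'rV[R]_4 :=
  [set x | I (x 0 ir) /\ J (x 0 itheta)].

End Nariai.

(* Main.v *)
Require Import Defs.
From mathcomp Require Import all_boot all_order all_algebra.
From mathcomp Require Import all_classical all_reals all_analysis.
From mathcomp Require Import ring.
Import Order.TTheory GRing.Theory Num.Theory.
Import numFieldNormedType.Exports.
Set Implicit Arguments.
Unset Strict Implicit.
Unset Printing Implicit Defensive.
Local Open Scope classical_set_scope.
Local Open Scope ring_scope.

(** The metric is a product of two surfaces, g = E + F, where
    E = A (- xi^2 dt^2 + dr^2) and F = B (dtheta^2 + h^2 dphi^2).  Write
    k1 = xi'' / (A xi) and k2 = h'' / (B h); with the sign convention at hand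
    these are minus the Gaussian curvatures of the factors.  Then
    - R = k1/2 (E wedge E) + k2/2 (F wedge F) and S = k1 E + k2 F;
    - every tensor of the theorem (R, P, C, W, and the products g wedge g,
      g wedge S, S wedge S) is a combination of the four tensors
        E_ps E_qr - E_qs E_pr,  F_ps F_qr - F_qs F_pr,
        E_ps F_qr - E_qs F_pr,  F_ps E_qr - F_qs E_pr,
      which [block_tensor] packages ([nariai_riemann], [nariai_conformal],
      [nariai_projective], [nariai_concircular]);
    - E and F are parallel ([part_parallel]), so covariant differentiation of
      such a combination only differentiates its coefficients
      ([nabla_block]).

    The pointwise claims are then polynomial identities in the entries of E and
    F.  In U . R only the mixed part of U survives, since the curvature operator
    of a surface is an infinitesimal isometry of its tangent planes and
    annihilates its curvature tensor ([tdot_block]).  The tensor R has no mixed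
    part, whence R . R = 0, and that of C is a multiple of that of g wedge g,
    whence C . R = (k1 + k2)/6 Q(g, R).  The compatibility of S with every block
    tensor is the first Bianchi identity on each factor, together with a
    cancellation in the mixed part ([block_compatible]).

    The recurrence claims reduce to four scalar equations between k1, k2 and
    their differentials ([sgk_block]), which are solved by rational expressions
    in k1, k2, dk1, dk2 with denominators k1, k2 and k1 - k2 (or k1 + k2 for C).
    The same formulas remain correct where a denominator vanishes, because
    0^-1 = 0: on the regular sets a denominator that vanishes at a point
    vanishes nearby ([steady_zeros]).  There its differential vanishes too, and
    if k1 = k2 nearby then both curvatures are locally constant, as k1 depends
    on r alone and k2 on theta alone ([equal_curvatures_partial]).  For the same
    reason the inverses involved are smooth ([smooth_onV]). *)

(** * Smooth functions on an open set *)

Lemma near_eq_differentiable (R : numFieldType) (V W : normedModType R)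
    (f g : V -> W) (x : V) :
  (\near x, f x = g x) -> differentiable f x -> differentiable g x.
Proof.
move=> fg df; have [dfc dfE] := (diff_locallyP _ _).1 df.
have fg0 : \forall y \near (0 : V), f (y + x) = g (y + x).
  by have := fg; rewrite (near_shift 0) subr0.
(* Equal germs have equal difference quotients, so the differential of f is
   also one for g. *)
have dg : g \o shift x = cst (g x) + 'd f x +o_ (0 : V) id.
  apply/eqaddoP => e e0; move/eqaddoP: dfE => /(_ e e0).
  by apply: filterS2 fg0 => y; rewrite !fctE /= -(nbhs_singleton fg) => ->.
by apply/diff_locallyP; rewrite (diff_unique dfc dg).
Qed.

Section Smooth.
Variables (R : realType) (U : set 'rV[R]_4).
Hypothesis openU : open U.
Implicit Types f g : 'rV[R]_4 -> R.

Lemma nbhs_on (f g : 'rV[R]_4 -> R) x : {in U, f =1 g} -> U x -> \near x, f x = g x.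
Proof.
move=> fg Ux; apply: filterS (open_nbhs_nbhs (conj openU Ux)) => y Uy.
exact/fg/mem_set.
Qed.

(** Smoothness refined by order.  The derivative of a product or of an inverse
    involves the function itself as well as its derivatives, so closure
    properties are proved by induction on the order and not on the list of
    differentiation indices. *)
Fixpoint times_differentiable (k : nat) f : Prop :=
  (forall x, U x -> differentiable f x) /\
  if k is k'.+1 then forall i, times_differentiable k' (partial i f) else True.

Lemma times_differentiableW k f :
  times_differentiable k f -> forall x, U x -> differentiable f x.
Proof. by case: k => [|k] []. Qed.

Lemma times_differentiableS k f :
  times_differentiable k.+1 f -> times_differentiable k f.
Proof.
elim: k f => [|k IH] f [df dpf]; split => // i; exact: IH.
Qed.

Lemma partial_eq_on f g i : {in U, f =1 g} -> {in U, partial i f =1 partial i g}.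
Proof. by move=> fg x /set_mem Ux; apply/near_eq_derive/nbhs_on. Qed.

Lemma times_differentiable_eq k f g :
  {in U, f =1 g} -> times_differentiable k f -> times_differentiable k g.
Proof.
elim: k f g => [|k IH] f g fg [df dpf]; split=> //;
  try by move=> x Ux; apply: near_eq_differentiable (df x Ux); apply: nbhs_on.
by move=> i; apply: IH (dpf i); apply: partial_eq_on.
Qed.

(** In an iterated derivative the index at the end of the list is
    differentiated first, and that is the derivative peeled off by
    [times_differentiable]; hence the induction from the right. *)
Lemma smooth_onE f :
  smooth_on U f <-> forall k, times_differentiable k f.
Proof.
split=> [sf k|df s].
  elim: k f sf => [|k IH] f sf; split=> //; try exact: (sf [::]).
  move=> i; apply: IH => s x Ux.
  by rewrite -[partial i f]/(foldr (@partial R) f [:: i]) -foldr_cat; apply: sf.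
elim/last_ind: s f df => [|s i IH] f df; first exact: (df 0%N).1.
rewrite -cats1 foldr_cat /=; apply: IH => k; exact: (df k.+1).2.
Qed.

Lemma smooth_on_eq f g : {in U, f =1 g} -> smooth_on U f -> smooth_on U g.
Proof.
move=> fg /smooth_onE df; apply/smooth_onE => k.
exact: times_differentiable_eq (df k).
Qed.

Lemma smooth_on_differentiable f x : smooth_on U f -> U x -> differentiable f x.
Proof. by move=> sf; apply: (sf [::]). Qed.

Lemma smooth_on_partial i f : smooth_on U f -> smooth_on U (partial i f).
Proof. by move=> /smooth_onE df; apply/smooth_onE => k; exact: (df k.+1).2. Qed.

Lemma partialD i f g x : differentiable f x -> differentiable g x ->
  partial i (fun y => f y + g y) x = partial i f x + partial i g x.
Proof. by move=> df dg; apply: deriveD; apply: diff_derivable. Qed.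

Lemma partialB i f g x : differentiable f x -> differentiable g x ->
  partial i (fun y => f y - g y) x = partial i f x - partial i g x.
Proof. by move=> df dg; apply: deriveB; apply: diff_derivable. Qed.

Lemma partialM i f g x : differentiable f x -> differentiable g x ->
  partial i (fun y => f y * g y) x = f x * partial i g x + g x * partial i f x.
Proof. by move=> df dg; apply: deriveM; apply: diff_derivable. Qed.

Lemma partial_cst i (c : R) x : partial i (fun=> c) x = 0.
Proof. exact: derive_cst. Qed.

Lemma smooth_on_cst (c : R) : smooth_on U (fun=> c).
Proof.
apply/smooth_onE => k; elim: k c => [|k IH] c; split=> // i.
by apply: times_differentiable_eq (IH 0) => x _; rewrite partial_cst.
Qed.

Lemma times_differentiableD k f g :
  times_differentiable k f -> times_differentiable k g ->
  times_differentiable k (fun x => f x + g x).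
Proof.
elim: k f g => [|k IH] f g [df dpf] [dg dpg]; split=> //;
  try by move=> x Ux; apply: differentiableD; auto.
move=> i; apply: times_differentiable_eq (IH _ _ (dpf i) (dpg i)).
by move=> x /set_mem Ux; rewrite partialD; auto.
Qed.

Lemma times_differentiableM k f g :
  times_differentiable k f -> times_differentiable k g ->
  times_differentiable k (fun x => f x * g x).
Proof.
elim: k f g => [|k IH] f g df dg.
  by split=> // x Ux; apply: differentiableM; [apply: df.1|apply: dg.1].
have [[df0 dpf] [dg0 dpg]] := (df, dg).
split; first by move=> x Ux; apply: differentiableM; auto.
move=> i; apply: (@times_differentiable_eq _
  (fun x => f x * partial i g x + g x * partial i f x)).
  by move=> x /set_mem Ux; rewrite partialM; auto.
by apply: times_differentiableD; apply: IH (dpg i) || apply: IH (dpf i);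
  apply: times_differentiableS.
Qed.

(** For a smooth f, this makes the pointwise inverse with 0^-1 = 0 smooth too:
    near each point it is either an honest inverse or zero. *)
Definition steady_zeros f :=
  forall x, U x -> f x != 0 \/ \near x, f x = 0.

Lemma smooth_onD f g :
  smooth_on U f -> smooth_on U g -> smooth_on U (fun x => f x + g x).
Proof.
move=> /smooth_onE df /smooth_onE dg; apply/smooth_onE => k.
exact: (times_differentiableD (df k) (dg k)).
Qed.

Lemma smooth_onM f g :
  smooth_on U f -> smooth_on U g -> smooth_on U (fun x => f x * g x).
Proof.
move=> /smooth_onE df /smooth_onE dg; apply/smooth_onE => k.
exact: (times_differentiableM (df k) (dg k)).
Qed.

Lemma smooth_onN f : smooth_on U f -> smooth_on U (fun x => - f x).
Proof.
move=> sf; apply: (@smooth_on_eq (fun x => -1 * f x)).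
  by move=> x _; rewrite mulN1r.
exact/smooth_onM/sf/smooth_on_cst.
Qed.

Lemma smooth_onB f g :
  smooth_on U f -> smooth_on U g -> smooth_on U (fun x => f x - g x).
Proof. by move=> sf sg; apply/smooth_onD/smooth_onN. Qed.

Lemma smooth_onX n f : smooth_on U f -> smooth_on U (fun x => f x ^+ n).
Proof.
move=> sf; elim: n => [|n IH]; first exact: smooth_on_cst.
by apply: (@smooth_on_eq (fun x => f x * f x ^+ n)) (smooth_onM sf IH) => x _;
  rewrite exprS.
Qed.

(** The formula (1/f)' = - f' / f^2 holds also where f vanishes identically,
    both sides being zero; the induction on the order therefore runs without
    distinguishing the two kinds of points. *)
Lemma smooth_onV f :
  smooth_on U f -> steady_zeros f -> smooth_on U (fun x => (f x)^-1).
Proof.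
move=> /smooth_onE df f0; apply/smooth_onE.
have dV x : U x -> differentiable (fun y => (f y)^-1) x /\
    forall i, partial i (fun y => (f y)^-1) x
      = - (partial i f x * ((f x)^-1 * (f x)^-1)).
  move=> Ux; have dfx := times_differentiableW (df 0%N) Ux.
  have [fx0|fx0] := f0 _ Ux.
    split=> [|i]; first exact: differentiableV.
    rewrite /partial (deriveV fx0); last exact: diff_derivable.
    by rewrite scaleNr -exprVn expr2 /GRing.scale /= [in RHS]mulrC.
  have fV0 : \near x, (cst 0 : _ -> R) x = (f x)^-1.
    by apply: filterS fx0 => y ->; rewrite invr0.
  split=> [|i]; first exact: near_eq_differentiable fV0 (differentiable_cst _ _).
  rewrite /partial -(near_eq_derive _ fV0) derive_cst (nbhs_singleton fx0).
  by rewrite invr0 !mulr0 oppr0.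
elim=> [|k IH].
  by split=> // x Ux; have [] := dV _ Ux.
split=> [x Ux|i]; first by have [] := dV _ Ux.
apply: (@times_differentiable_eq _
  (fun x => -1 * (partial i f x * ((f x)^-1 * (f x)^-1)))).
  by move=> x /set_mem Ux; have [_ ->] := dV _ Ux; rewrite mulN1r.
apply: times_differentiableM; first exact: ((smooth_onE _).1 (smooth_on_cst _)).
by apply: times_differentiableM; [apply (df k.+1).2|apply: times_differentiableM].
Qed.

Lemma smooth_onV_neq0 f :
  smooth_on U f -> (forall x, U x -> f x != 0) -> smooth_on U (fun x => (f x)^-1).
Proof. by move=> sf f0; apply: smooth_onV => // x Ux; left; apply: f0. Qed.

End Smooth.

Lemma smooth_on_subset (R : realType) (U V : set 'rV[R]_4) f :
  V `<=` U -> smooth_on U f -> smooth_on V f.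
Proof. by move=> VU sf s x Vx; apply/sf/VU. Qed.

(** On functions of one coordinate, partial derivatives are ordinary
    derivatives even where those do not exist: both sides are the limit of the
    same difference quotient, so F is arbitrary. *)
Lemma partial_coord (R : realType) (i j : 'I_4) (F : R -> R) (x : 'rV[R]_4) :
  partial i (fun y => F (y 0 j)) x = (i == j)%:R * derive1 F (x 0 j).
Proof.
rewrite /partial derive1E /derive; have [<-|ij] := eqVneq i j.
  rewrite mul1r; do 2 f_equal; apply/funext => e /=.
  by rewrite !mxE !eqxx.
rewrite mul0r -[RHS](@derive_cst R _ _ (0 : R) x (delta_mx 0 i)) /derive.
do 2 f_equal; apply/funext => e /=.
by rewrite !mxE eqxx [j == i]eq_sym (negPf ij) mulr0 add0r !subrr !scaler0.
Qed.

(** Differentiation in coordinate i turns F into 0 or F', so the induction has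
    to run over all iterated derivatives of F at once. *)
Lemma smooth_on_coord (R : realType) (U : set 'rV[R]_4) (I : set R)
    (F : R -> R) (j : 'I_4) :
  open U -> (forall x, U x -> I (x 0 j)) -> smooth_on1 I F ->
  smooth_on U (fun y => F (y 0 j)).
Proof.
move=> oU UI sF; apply/smooth_onE => // k.
have dcoord n x : U x ->
    differentiable (fun y : 'rV[R]_4 => derive1n n F (y 0 j)) x.
  move=> Ux; apply: (@differentiable_comp R _ _ _ (fun y : 'rV[R]_4 => y 0 j)).
    exact: differentiable_coord.
  exact/derivable1_diffP/sF/UI.
suff: forall n, times_differentiable U k (fun y : 'rV[R]_4 => derive1n n F (y 0 j)).
  by move=> /(_ 0%N).
elim: k => [|k IH] n; split=> //; try exact: dcoord.
move=> i; apply: (@times_differentiable_eq _ _ oU _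
  (fun y => (i == j)%:R * derive1n n.+1 F (y 0 j))).
  by move=> x _; rewrite partial_coord derive1nS.
apply: times_differentiableM => //.
exact: ((smooth_onE _ _).1 (smooth_on_cst oU _)).
Qed.

Lemma partial_near0 (R : realType) (a : 'I_4) (f : 'rV[R]_4 -> R) x :
  (\near x, f x = 0) -> partial a f x = 0.
Proof.
move=> f0; rewrite /partial (near_eq_derive (delta_mx 0 a) (g := cst 0)) //.
exact: derive_cst.
Qed.

(** What keeps formulas with division valid at the zeros of a denominator: its
    differential vanishes there as well. *)
Lemma steady_partial (R : realType) (U : set 'rV[R]_4) (a : 'I_4) f x :
  steady_zeros U f -> U x -> f x = 0 -> partial a f x = 0.
Proof.
by move=> sf /sf[/negPf f0 fx0|f0 _]; [rewrite fx0 eqxx in f0|exact: partial_near0].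
Qed.

Lemma near_neq0 (R : realType) (f : 'rV[R]_4 -> R) x : differentiable f x -> f x != 0 ->
  \near x, f x != 0.
Proof.
move=> /differentiable_continuous fc fx0.
apply: (fc [set y | y != 0]).
by apply: open_nbhs_nbhs; split=> //; exact: open_neq.
Qed.

Lemma smooth_form_row (R : realType) (U : set 'rV[R]_4) (F : 'I_4 -> 'rV[R]_4 -> R) :
  open U -> (forall i, smooth_on U (F i)) -> smooth_form U (fun x => \row_i F i x).
Proof. by move=> oU sF i; apply: (smooth_on_eq oU _ (sF i)) => x _; rewrite mxE. Qed.

Lemma smooth_form0 (R : realType) (U : set 'rV[R]_4) : open U -> smooth_form U (fun=> 0).
Proof.
move=> oU i; apply: (smooth_on_eq oU _ (smooth_on_cst oU 0)) => x _.
by rewrite mxE.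
Qed.

Lemma open_locally_constant_part (R : realType) (D : set 'rV[R]_4) (T : Type)
    (f : 'rV[R]_4 -> T) :
  open D -> open (locally_constant_part D f).
Proof.
move=> oD; rewrite openE => x [Dx fx]; rewrite /interior.
have Dn : nbhs x D by apply: open_nbhs_nbhs.
apply: filterS2 Dn (nbhs_interior fx) => y Dy fy; split=> //.
by rewrite (nbhs_singleton fy).
Qed.

(** * One-variable derivatives *)

Lemma smooth_on1_derive1 (R : realType) (K : set R) (F : R -> R) :
  smooth_on1 K F -> smooth_on1 K (derive1 F).
Proof. by move=> sF n r Kr; rewrite -derive1Sn; exact: sF. Qed.

Lemma derive1_sqr (R : realType) (F : R -> R) r : derivable F r 1 ->
  derive1 (fun r => F r ^+ 2) r = 2 * F r * derive1 F r.
Proof.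
move=> dF; rewrite !derive1E (_ : (fun r => F r ^+ 2) = F ^+ 2) //.
rewrite deriveX // /GRing.scale /= expr1; ring.
Qed.

Lemma derive1M (R : realType) (F G : R -> R) r :
  derivable F r 1 -> derivable G r 1 ->
  derive1 (fun r => F r * G r) r = F r * derive1 G r + G r * derive1 F r.
Proof. by move=> dF dG; rewrite !derive1E; exact: (deriveM dF dG). Qed.

Lemma derive1V (R : realType) (F : R -> R) r : F r != 0 -> derivable F r 1 ->
  derive1 (fun r => (F r)^-1) r = - F r ^- 2 * derive1 F r.
Proof. by move=> F0 dF; rewrite !derive1E; exact: (deriveV F0 dF). Qed.

Lemma derive1_logarithmic (R : realType) (F : R -> R) r :
  F r != 0 -> derivable F r 1 -> derivable (derive1 F) r 1 ->
  derive1 (fun r => derive1 F r / F r) r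
  = (derive1 (derive1 F) r * F r - derive1 F r ^+ 2) / F r ^+ 2.
Proof.
move=> F0 dF dF1; rewrite (derive1M dF1 (derivableV F0 dF)) derive1V //.
set f := F r in F0 *; set f1 := derive1 F r; set f2 := derive1 _ r.
by field.
Qed.

Lemma derive1_mul_derive1 (R : realType) (F : R -> R) r :
  derivable F r 1 -> derivable (derive1 F) r 1 ->
  derive1 (fun r => F r * derive1 F r) r
  = derive1 F r ^+ 2 + F r * derive1 (derive1 F) r.
Proof. by move=> dF dF1; rewrite (derive1M dF dF1) expr2 addrC. Qed.

(** * Block tensors at a point *)

(** Case analysis on a coordinate index that leaves literal ordinals, on which
    the component formulas compute. *)
Lemma ord4_ind (P : 'I_4 -> Prop) :
  P (@Ordinal 4 0 isT) -> P (@Ordinal 4 1 isT) -> P (@Ordinal 4 2 isT) ->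
  P (@Ordinal 4 3 isT) -> forall i, P i.
Proof.
move=> P0 P1 P2 P3 [[|[|[|[|i]]]] hi] //.
- by rewrite (_ : Ordinal hi = @Ordinal 4 0 isT) //; apply: val_inj.
- by rewrite (_ : Ordinal hi = @Ordinal 4 1 isT) //; apply: val_inj.
- by rewrite (_ : Ordinal hi = @Ordinal 4 2 isT) //; apply: val_inj.
- by rewrite (_ : Ordinal hi = @Ordinal 4 3 isT) //; apply: val_inj.
Qed.

Section BlockTensors.
Variable R : realType.
Implicit Types (G : 'M[R]_4) (c : bool).

Definition in_block c (i : 'I_4) : R := ((i < 2)%N == c)%:R.

(** The restriction of G to one factor of the splitting {0, 1} + {2, 3} of the
    indices; true selects the first factor.  For block-diagonal G masking the
    row index suffices. *)
Definition part c G : 'M[R]_4 := \matrix_(i, j) (in_block c i * G i j).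

(** With E and F the two parts of G, the coefficients a and b multiply half the
    Kulkarni-Nomizu squares of E and F, while c and d multiply the two halves of
    E wedge F.  The halves are kept apart because they enter the projective
    curvature, which lacks the symmetries of a curvature tensor, with different
    coefficients. *)
Definition block_tensor G (a b c d : R) : tensor4 R := fun p q r s =>
  let E := part true G in let F := part false G in
  a * (E p s * E q r - E q s * E p r) + b * (F p s * F q r - F q s * F p r)
  + c * (E p s * F q r - E q s * F p r) + d * (F p s * E q r - F q s * E p r).

Lemma part_add G : part true G + part false G = G.
Proof.
apply/matrixP => i j; rewrite !mxE /in_block.
by case: (i < 2)%N; rewrite /= mul1r mul0r ?addr0 ?add0r.
Qed.

Variable d : 'rV[R]_4.
Hypothesis d_neq0 : forall i, d 0 i != 0.
Local Notation G := (diag_mx d).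

Lemma invmx_diag : invmx G = diag_mx (\row_i (d 0 i)^-1).
Proof.
have dV : diag_mx (\row_i (d 0 i)^-1) *m G = 1%:M.
  rewrite mulmx_diag -diag_const_mx; congr diag_mx.
  by apply/rowP => i; rewrite !mxE mulVf.
have [_ GU] := mulmx1_unit dV.
by rewrite -[LHS]mul1mx -dV mulmxK.
Qed.

Lemma part_sym c i j : part c G i j = part c G j i.
Proof.
by rewrite !mxE; case: eqVneq => [->|ij];
  rewrite ?eqxx //= ?mulr0 1?eq_sym ?(negPf ij) ?mulr0.
Qed.

(** Raising an index of a part of G yields the projection onto that factor. *)
Lemma invmx_part c a s :
  \sum_b invmx G a b * part c G s b = (a == s)%:R * in_block c s.
Proof.
rewrite invmx_diag (bigD1 a) //= big1 => [|b /negPf ba].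
  rewrite addr0 !mxE eqxx mulr1n eq_sym; case: eqVneq => [->|_].
    by rewrite mulr1n mulrCA mulVf // mulr1 mul1r.
  by rewrite mulr0n !mulr0 mul0r.
by rewrite !mxE eq_sym ba mulr0n mul0r.
Qed.

Lemma contract_part c (X : 'I_4 -> R) s :
  \sum_a \sum_b invmx G a b * (part c G s b * X a) = in_block c s * X s.
Proof.
have inner a : \sum_b invmx G a b * (part c G s b * X a)
    = (a == s)%:R * in_block c s * X a.
  by under eq_bigr do rewrite mulrA; rewrite -mulr_suml invmx_part.
rewrite (eq_bigr _ (fun a _ => inner a)) (bigD1 s) //= eqxx mul1r.
by rewrite big1 ?addr0 // => a /negPf ->; rewrite !mul0r.
Qed.

(** The contraction of one slot of T with the endomorphism that U . T uses; X
    stands for T as a function of that slot. *)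
Lemma contract_block (a b c e : R) (X : 'I_4 -> R) p r s :
  \sum_i \sum_j invmx G i j * (block_tensor G a b c e r s p j * X i)
  = let E := part true G in let F := part false G in
    (a * E s p + c * F s p) * (in_block true r * X r)
    - (a * E r p + c * F r p) * (in_block true s * X s)
    + (b * F s p + e * E s p) * (in_block false r * X r)
    - (b * F r p + e * E r p) * (in_block false s * X s).
Proof.
rewrite /= -!contract_part !mulr_sumr -!(sumrB, big_split) /=.
apply: eq_bigr => i _; rewrite !mulr_sumr -!(sumrB, big_split) /=.
by apply: eq_bigr => j _; rewrite /block_tensor; ring.
Qed.

Lemma sum_in_block c : \sum_i in_block c i = 2.
Proof. by rewrite !big_ord_recl big_ord0 /in_block /=; case: c => /=; ring. Qed.

Lemma ricci_contract (k1 k2 : R) q r :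
  \sum_p \sum_s invmx G p s * block_tensor G k1 k2 0 0 p q r s
  = k1 * part true G q r + k2 * part false G q r.
Proof.
have tr c : \sum_i \sum_j invmx G i j * (part c G i j * part c G q r)
    = 2 * part c G q r.
  rewrite -(sum_in_block c) mulr_suml; apply: eq_bigr => i _.
  under eq_bigr do rewrite mulrA.
  by rewrite -mulr_suml invmx_part eqxx mul1r.
have ct c : \sum_i \sum_j invmx G i j * (part c G q j * part c G i r)
    = part c G q r.
  rewrite contract_part !mxE mulrA /in_block.
  by case: eqP; rewrite /= ?mul1r ?mul0r.
have -> : k1 * part true G q r + k2 * part false G q r
   = k1 * (2 * part true G q r - part true G q r)
     + k2 * (2 * part false G q r - part false G q r) by ring.
rewrite -!tr -[in X in k1 * (_ - X)]ct -[in X in k2 * (_ - X)]ct.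
rewrite -!sumrB !mulr_sumr -!big_split /=; apply: eq_bigr => i _.
rewrite -!sumrB !mulr_sumr -!big_split /=; apply: eq_bigr => j _.
by rewrite /block_tensor; ring.
Qed.

(** In the form used for rewriting: an index either lies in factor c, and
    then every entry of the other part with that index is zero, or vice
    versa. *)
Lemma in_blockP c i :
  (in_block c i = 1 /\
     forall j, part (~~ c) G i j = 0 /\ part (~~ c) G j i = 0) \/
  (in_block c i = 0 /\ forall j, part c G i j = 0 /\ part c G j i = 0).
Proof.
rewrite /in_block; case: eqP => [ic|/eqP ic]; [left|right]; split=> // j.
  by rewrite [part _ _ j i]part_sym !mxE /in_block ic; case: (c); rewrite mul0r.
by rewrite [part _ _ j i]part_sym !mxE /in_block (negPf ic) mul0r.
Qed.

(** A tensor without mixed part is supported on index quadruples within one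
    factor, so projecting any one slot onto a factor selects the matching
    summand. *)
Lemma in_block_curvature c (k1 k2 : R) p q r s :
  let T := block_tensor G k1 k2 0 0 in
  let Tc := if c then block_tensor G k1 0 0 0 else block_tensor G 0 k2 0 0 in
  [/\ in_block c p * T p q r s = Tc p q r s,
      in_block c q * T p q r s = Tc p q r s,
      in_block c r * T p q r s = Tc p q r s
    & in_block c s * T p q r s = Tc p q r s].
Proof.
rewrite /block_tensor; split;
  [case: (in_blockP c p)|case: (in_blockP c q)
  |case: (in_blockP c r)|case: (in_blockP c s)] => -[-> z];
  case: c z => /= z; rewrite ?(fun j => (z j).1) ?(fun j => (z j).2); ring.
Qed.

Lemma in_block_last k (a b c e : R) p q r s :
  in_block k s * block_tensor G a b c e p q r s =
  (if k then block_tensor G a 0 c 0 else block_tensor G 0 b 0 e) p q r s.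
Proof.
rewrite /block_tensor; case: (in_blockP k s) => -[-> z];
  case: k z => /= z; rewrite ?(fun j => (z j).1) ?(fun j => (z j).2); ring.
Qed.

Lemma ricci_up_block (k1 k2 : R) t p :
  (invmx G *m (k1 *: part true G + k2 *: part false G)) t p
  = (t == p)%:R * (k1 * in_block true p + k2 * in_block false p).
Proof.
have -> : (t == p)%:R * (k1 * in_block true p + k2 * in_block false p)
   = k1 * ((t == p)%:R * in_block true p) + k2 * ((t == p)%:R * in_block false p).
  by ring.
rewrite mxE -!invmx_part !mulr_sumr -big_split /=; apply: eq_bigr => u _.
rewrite (part_sym true p) (part_sym false p).
have -> : (k1 *: part true G + k2 *: part false G) u p
  = k1 * part true G u p + k2 * part false G u p by rewrite !mxE.
by ring.
Qed.

(** Raising an index of S gives k1 on the first factor and k2 on the second, so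
    the sum splits into cyclic sums of block tensors.  They vanish: the pure
    parts by the Bianchi identity, and the mixed ones because their six
    terms cancel in pairs. *)
Lemma block_compatible (k1 k2 a b c e : R) p q r s :
  let B := block_tensor G a b c e in
  let S := invmx G *m (k1 *: part true G + k2 *: part false G) in
  \sum_t (S t p * B q r s t + S t q * B r p s t + S t r * B p q s t) = 0.
Proof.
move=> B S.
have contract i (X : 'I_4 -> R) : \sum_t S t i * X t
    = k1 * (in_block true i * X i) + k2 * (in_block false i * X i).
  rewrite (bigD1 i) //= big1 ?addr0 => [|t /negPf ti]; rewrite ricci_up_block.
    by rewrite eqxx mul1r; ring.
  by rewrite ti !mul0r.
rewrite !big_split /= (contract p (fun t => B q r s t)).
rewrite (contract q (fun t => B r p s t)) (contract r (fun t => B p q s t)).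
rewrite /B !in_block_last /block_tensor.
rewrite !(part_sym _ q p) !(part_sym _ r p) !(part_sym _ r q).
ring.
Qed.

(** Besides the symmetry of the two parts of G, the identities that follow are
    formal polynomial ones; ordering the indices of every entry makes the
    symmetry visible to ring. *)
Ltac sort_indices p1 p2 p3 p4 r s :=
  let sort i j := (rewrite ?(part_sym true i j) ?(part_sym false i j)) in
  sort p2 p1; sort p3 p1; sort p4 p1; sort p3 p2; sort p4 p2; sort p4 p3;
  rewrite ?(part_sym true r) ?(part_sym false r);
  rewrite ?(part_sym true s) ?(part_sym false s).

(** Q(E, E wedge E) = 0 and Q(F, F wedge F) = 0, so only the cross terms
    remain. *)
Lemma tachibana_block (k1 k2 : R) p1 p2 p3 p4 r s :
  tachibana G (block_tensor G k1 k2 0 0) p1 p2 p3 p4 r s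
  = tachibana (part false G) (block_tensor G k1 0 0 0) p1 p2 p3 p4 r s
    + tachibana (part true G) (block_tensor G 0 k2 0 0) p1 p2 p3 p4 r s.
Proof.
have GE i j : G i j = part true G i j + part false G i j.
  by rewrite -{1}(part_add G) mxE.
rewrite /tachibana /block_tensor !GE.
sort_indices p1 p2 p3 p4 r s.
ring.
Qed.

(** The coefficients a and b drop out because the curvature operator of a
    surface is an infinitesimal isometry of its tangent planes, hence annihilates
    the tensor built from the metric of that surface; only the mixed part of U
    moves the factors into each other. *)
Lemma tdot_block (a b c e k1 k2 : R) x (g : 'rV[R]_4 -> 'M[R]_4) p1 p2 p3 p4 r s :
  g x = G ->
  tdot g x (block_tensor G a b c e) (block_tensor G k1 k2 0 0) p1 p2 p3 p4 r s
  = - (c * tachibana (part false G) (block_tensor G k1 0 0 0) p1 p2 p3 p4 r s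
       + e * tachibana (part true G) (block_tensor G 0 k2 0 0) p1 p2 p3 p4 r s).
Proof.
move=> gx; set T := block_tensor G k1 k2 0 0.
transitivity (- (
   \sum_i \sum_j invmx G i j * (block_tensor G a b c e r s p1 j * T i p2 p3 p4)
   + \sum_i \sum_j invmx G i j * (block_tensor G a b c e r s p2 j * T p1 i p3 p4)
   + \sum_i \sum_j invmx G i j * (block_tensor G a b c e r s p3 j * T p1 p2 i p4)
   + \sum_i \sum_j invmx G i j * (block_tensor G a b c e r s p4 j * T p1 p2 p3 i))).
  rewrite /tdot gx -!big_split /=; congr (- _); apply: eq_bigr => i _.
  by rewrite -!big_split /=; apply: eq_bigr => j _; ring.
rewrite (contract_block _ _ _ _ (fun i => T i p2 p3 p4)).
rewrite (contract_block _ _ _ _ (fun i => T p1 i p3 p4)).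
rewrite (contract_block _ _ _ _ (fun i => T p1 p2 i p4)).
rewrite (contract_block _ _ _ _ (fun i => T p1 p2 p3 i)) /=.
have t c' i q2 q3 q4 :=
  let: And4 slot _ _ _ := in_block_curvature c' k1 k2 i q2 q3 q4 in slot.
have t2 c' q1 i q3 q4 :=
  let: And4 _ slot _ _ := in_block_curvature c' k1 k2 q1 i q3 q4 in slot.
have t3 c' q1 q2 i q4 :=
  let: And4 _ _ slot _ := in_block_curvature c' k1 k2 q1 q2 i q4 in slot.
have t4 c' q1 q2 q3 i :=
  let: And4 _ _ _ slot := in_block_curvature c' k1 k2 q1 q2 q3 i in slot.
rewrite !t !t2 !t3 !t4 /tachibana /block_tensor.
sort_indices p1 p2 p3 p4 r s.
ring.
Qed.

End BlockTensors.

(** * The Levi-Civita connection and the curvature of the product metric *)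

(** The Christoffel symbols Gamma^k_ij of the product metric, where
    u = Gamma^0_01, v = Gamma^1_00, w = Gamma^3_23 and z = Gamma^2_33. *)
Definition gamma (R : realType) (u v w z : R) (k i j : nat) : R :=
  match k, i, j with
  | 0, 0, 1 | 0, 1, 0 => u
  | 1, 0, 0 => v
  | 3, 2, 3 | 3, 3, 2 => w
  | 2, 3, 3 => z
  | _, _, _ => 0%R
  end%N.

(** The derivative of [gamma] in direction a, given the derivatives of u and v
    in r and those of w and z in theta. *)
Definition dgamma (R : realType) (u v w z : R) (a k i j : nat) : R :=
  match a with
  | 1 => gamma u v 0%R 0%R k i j
  | 2 => gamma 0%R 0%R w z k i j
  | _ => 0%R
  end%N.

Definition metric_entry (R : realType) (A B f h : R) (i : nat) : R :=
  nth 0 [:: - (A * f ^+ 2); A; B; B * h ^+ 2] i.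

(** The curvature tensor in coordinates, with f, f1, f2 for the value and the
    first two derivatives of xi at a point, and likewise for h.  Everything is
    explicit; antisymmetry in the first pair leaves six pairs p < q. *)
Lemma curvature_algebra (R : realType) (A B f f1 f2 h h1 h2 : R) (p q r s : 'I_4) :
  A != 0 -> B != 0 -> f != 0 -> h != 0 ->
  let Gam := gamma (f1 / f) (f * f1) (h1 / h) (- (h * h1)) in
  let dGam := dgamma ((f2 * f - f1 ^+ 2) / f ^+ 2) (f1 ^+ 2 + f * f2)
                     ((h2 * h - h1 ^+ 2) / h ^+ 2) (- (h1 ^+ 2 + h * h2)) in
  let E (i j : 'I_4) := ((i < 2)%N == true)%:R * (metric_entry A B f h i *+ (i == j)) in
  let F (i j : 'I_4) := ((i < 2)%N == false)%:R * (metric_entry A B f h i *+ (i == j)) in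
  metric_entry A B f h r * (dGam p r q s - dGam q r p s
    + \sum_(u < 4) (Gam r p u * Gam u q s - Gam r q u * Gam u p s))
  = f2 / (A * f) * (E p s * E q r - E q s * E p r)
    + h2 / (B * h) * (F p s * F q r - F q s * F p r).
Proof.
move=> A0 B0 f0 h0 Gam dGam E F; rewrite !big_ord_recl big_ord0.
wlog: p q / (p < q)%N => [ordered|].
  have [/ordered//|qp|/val_inj ->] := ltngtP p q; last by ring.
  have /eqP := ordered _ _ qp; rewrite -subr_eq0 -oppr_eq0 => /eqP swapped.
  by apply: subr0_eq; rewrite -[RHS]swapped; ring.
rewrite /Gam /dGam /E /F {Gam dGam E F} -!val_eqE.
elim/ord4_ind: p; elim/ord4_ind: q => pq; try discriminate pq;
  elim/ord4_ind: r; elim/ord4_ind: s.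
all: rewrite /gamma /dgamma /metric_entry /bump /=.
all: try ring.
all: by field; rewrite ?A0 ?B0 ?f0 ?h0.
Qed.

Section NariaiGeometry.
Variables (R : realType) (A B : R) (I J : set R) (xi h : R -> R).
Hypotheses (A0 : A != 0) (B0 : B != 0).
Hypotheses (openI : open I) (openJ : open J).
Hypotheses (xi_smooth : smooth_on1 I xi) (h_smooth : smooth_on1 J h).
Hypotheses (xi_neq0 : forall r, I r -> xi r != 0).
Hypotheses (h_neq0 : forall theta, J theta -> h theta != 0).

Definition metric_diagonal (x : 'rV[R]_4) : 'rV[R]_4 :=
  \row_(i < 4) metric_entry A B (xi (x 0 ir)) (h (x 0 itheta)) i.

Let g (x : 'rV[R]_4) : 'M[R]_4 := diag_mx (metric_diagonal x).
Let D : set 'rV[R]_4 := nariai_chart I J.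
Local Notation d := metric_diagonal.

Lemma nariai_metricE x : g x = diag_mx (d x).
Proof. by []. Qed.

Lemma nariai_entry x i j :
  g x i j = metric_entry A B (xi (x 0 ir)) (h (x 0 itheta)) i *+ (i == j).
Proof. by rewrite nariai_metricE !mxE. Qed.

Lemma nariai_diag_neq0 x : D x -> forall i, d x 0 i != 0.
Proof.
move=> [/xi_neq0 x0 /h_neq0 hx0] i; rewrite mxE.
by elim/ord4_ind: i; rewrite /metric_entry /= ?oppr_eq0 ?mulf_eq0 ?sqrf_eq0
  ?(negPf A0) ?(negPf B0) ?(negPf x0) ?(negPf hx0).
Qed.

Lemma open_chart : open D.
Proof.
have -> : D = ((fun x : 'rV[R]_4 => x 0 ir) @^-1` I)
    `&` ((fun x : 'rV[R]_4 => x 0 itheta) @^-1` J) by [].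
apply: topology_structure.openI; apply: open_comp => // x _;
  exact: coord_continuous.
Qed.

Lemma xi_coord_smooth : smooth_on D (fun y => xi (y 0 ir)).
Proof. by apply: (smooth_on_coord open_chart _ xi_smooth) => x []. Qed.

Lemma h_coord_smooth : smooth_on D (fun y => h (y 0 itheta)).
Proof. by apply: (smooth_on_coord open_chart _ h_smooth) => x []. Qed.

Lemma metric_smooth i j : smooth_on D (fun y => g y i j).
Proof.
have oD := open_chart.
apply: (@smooth_on_eq _ _ oD (fun y =>
  metric_entry A B (xi (y 0 ir)) (h (y 0 itheta)) i *+ (i == j))).
  by move=> x _; rewrite nariai_entry.
case: (i == j); last exact: smooth_on_cst.
rewrite /= /metric_entry; elim/ord4_ind: i => /=;
  do ?[exact: xi_coord_smooth | exact: h_coord_smooth | exact: smooth_on_cst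
      | apply: smooth_onN | apply: smooth_onX | apply: smooth_onM] => //.
Qed.

Definition metric_partial (x : 'rV[R]_4) (a i : nat) : R :=
  match a, i with
  | 1, 0 => - (2 * A * xi (x 0%R ir) * derive1 xi (x 0%R ir))%R
  | 2, 3 => (2 * B * h (x 0%R itheta) * derive1 h (x 0%R itheta))%R
  | _, _ => 0%R
  end%N.

Lemma partial_metric a i j x : D x ->
  partial a (fun y => g y i j) x = metric_partial x a i *+ (i == j).
Proof.
move=> Dx; have [Ix Jx] := Dx.
have -> : (fun y => g y i j) =
  (fun y => metric_entry A B (xi (y 0 ir)) (h (y 0 itheta)) i *+ (i == j)).
  by apply/funext => y; rewrite nariai_entry.
have dxi : derivable xi (x 0 ir) 1 := xi_smooth (k := 0) Ix.
have dh : derivable h (x 0 itheta) 1 := h_smooth (k := 0) Jx.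
have dX (F : R -> R) r : derivable F r 1 -> derivable (fun r => F r ^+ 2) r 1.
  by move=> dF; exact: (derivableM dF dF).
case: (i == j); last by rewrite /= partial_cst mulr0n.
rewrite !mulr1n /metric_entry; elim/ord4_ind: i => /=.
- rewrite (partial_coord a ir (fun r => - (A * xi r ^+ 2))).
  have -> : derive1 (fun r => - (A * xi r ^+ 2)) (x 0 ir)
      = - (2 * A * xi (x 0 ir) * derive1 xi (x 0 ir)).
    rewrite (_ : (fun r => - (A * xi r ^+ 2)) = (fun r => (- A) * xi r ^+ 2));
      last by apply/funext => r; rewrite mulNr.
    rewrite derive1Ml; last exact: dX.
    by rewrite derive1_sqr //; ring.
  by rewrite /metric_partial; elim/ord4_ind: a; rewrite -val_eqE /= ?mul0r ?mul1r.
- by rewrite partial_cst /metric_partial; elim/ord4_ind: a.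
- by rewrite partial_cst /metric_partial; elim/ord4_ind: a.
- rewrite (partial_coord a itheta (fun r => B * h r ^+ 2)).
  rewrite derive1Ml; last exact: dX.
  rewrite derive1_sqr //.
  by rewrite /metric_partial; elim/ord4_ind: a;
    rewrite -val_eqE /= ?mul0r ?mul1r //; ring.
Qed.

Definition gamma_t (r : R) : R := derive1 xi r / xi r.
Definition gamma_r (r : R) : R := xi r * derive1 xi r.
Definition gamma_phi (r : R) : R := derive1 h r / h r.
Definition gamma_theta (r : R) : R := - (h r * derive1 h r).

(** Since g is diagonal, the sum over the raised index has one term. *)
Lemma nariai_christoffel k i j x : D x ->
  christoffel g k i j x
  = gamma (gamma_t (x 0 ir)) (gamma_r (x 0 ir))
          (gamma_phi (x 0 itheta)) (gamma_theta (x 0 itheta)) k i j.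
Proof.
move=> Dx; rewrite /christoffel nariai_metricE (invmx_diag (nariai_diag_neq0 Dx)).
rewrite (bigD1 k) //= big1 ?addr0 => [|l /negPf lk]; last first.
  by rewrite !mxE eq_sym lk mulr0n mul0r.
rewrite !mxE eqxx mulr1n !partial_metric //.
have [/xi_neq0 x0 /h_neq0 hx0] := Dx.
rewrite /gamma_t /gamma_r /gamma_phi /gamma_theta -!val_eqE.
elim/ord4_ind: k; elim/ord4_ind: i; elim/ord4_ind: j;
  rewrite /gamma /metric_partial /metric_entry /=;
  first [ring | by field; rewrite ?A0 ?B0 ?x0 ?hx0].
Qed.

Let xi1 := derive1 xi.
Let xi2 := derive1 xi1.
Let h1 := derive1 h.
Let h2 := derive1 h1.

Lemma partial_christoffel a k i j x : D x ->
  partial a (christoffel g k i j) x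
  = dgamma ((xi2 (x 0 ir) * xi (x 0 ir) - xi1 (x 0 ir) ^+ 2) / xi (x 0 ir) ^+ 2)
           (xi1 (x 0 ir) ^+ 2 + xi (x 0 ir) * xi2 (x 0 ir))
           ((h2 (x 0 itheta) * h (x 0 itheta) - h1 (x 0 itheta) ^+ 2)
              / h (x 0 itheta) ^+ 2)
           (- (h1 (x 0 itheta) ^+ 2 + h (x 0 itheta) * h2 (x 0 itheta))) a k i j.
Proof.
move=> Dx; have [Ix Jx] := Dx.
have x0 := xi_neq0 Ix; have hx0 := h_neq0 Jx.
have dxi : derivable xi (x 0 ir) 1 := xi_smooth (k := 0) Ix.
have dh : derivable h (x 0 itheta) 1 := h_smooth (k := 0) Jx.
have dxi1 : derivable (derive1 xi) (x 0 ir) 1 := xi_smooth (k := 1) Ix.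
have dh1 : derivable (derive1 h) (x 0 itheta) 1 := h_smooth (k := 1) Jx.
rewrite (@partial_eq_on _ _ open_chart _ (fun y =>
  gamma (gamma_t (y 0 ir)) (gamma_r (y 0 ir))
        (gamma_phi (y 0 itheta)) (gamma_theta (y 0 itheta)) k i j)); first last.
- exact/mem_set.
- by move=> y /set_mem Dy; rewrite nariai_christoffel.
rewrite /xi2 /xi1 /h2 /h1 -derive1_logarithmic // -derive1_mul_derive1 //.
rewrite -derive1_logarithmic // -derive1_mul_derive1 //.
have -> : - derive1 (fun r => h r * derive1 h r) (x 0 itheta)
    = derive1 gamma_theta (x 0 itheta).
  by rewrite -(derive1N (derivableM dh dh1)).
rewrite -/gamma_t -/gamma_r -/gamma_phi.
have c F := partial_coord a ir F x; have c' F := partial_coord a itheta F x.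
elim/ord4_ind: k; elim/ord4_ind: i; elim/ord4_ind: j; rewrite /gamma /=
  ?partial_cst ?c ?c'; elim/ord4_ind: a {c c'} => /=;
  rewrite -?val_eqE /= ?mul1r ?mul0r; reflexivity.
Qed.

(** The eigenvalue of the Ricci tensor on the (t, r) factor. *)
Definition tr_curvature (x : 'rV[R]_4) : R := xi2 (x 0 ir) / (A * xi (x 0 ir)).

(** The eigenvalue of the Ricci tensor on the (theta, phi) factor. *)
Definition angular_curvature (x : 'rV[R]_4) : R :=
  h2 (x 0 itheta) / (B * h (x 0 itheta)).
Let k1 := tr_curvature.
Let k2 := angular_curvature.

Lemma nariai_riemann x : D x -> riemann g x = block_tensor (g x) (k1 x) (k2 x) 0 0.
Proof.
move=> Dx; apply/funext => p; apply/funext => q; apply/funext => r; apply/funext => s.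
rewrite /riemann (bigD1 r) //= big1 ?addr0 => [|t /negPf tr]; last first.
  by rewrite nariai_entry eq_sym tr mulr0n mul0r.
rewrite nariai_entry eqxx mulr1n /curvature_op !partial_christoffel //.
under eq_bigr do rewrite !nariai_christoffel //.
rewrite /gamma_t /gamma_r /gamma_phi /gamma_theta.
have [/xi_neq0 x0 /h_neq0 hx0] := Dx.
rewrite (curvature_algebra _ _ _ _ p q r s A0 B0 x0 hx0).
by rewrite /block_tensor /part !mxE /in_block !mul0r !addr0.
Qed.

Lemma nariai_ricci x : D x ->
  ricci g x = k1 x *: part true (g x) + k2 x *: part false (g x).
Proof.
move=> Dx; apply/matrixP => q r; rewrite mxE nariai_riemann //.
rewrite (ricci_contract (nariai_diag_neq0 Dx)) [RHS]mxE.
by congr (_ + _); rewrite [RHS]mxE.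
Qed.

Lemma nariai_scalar_curvature x : D x -> scalar_curvature g x = 2 * (k1 x + k2 x).
Proof.
move=> Dx; rewrite /scalar_curvature nariai_ricci //.
rewrite mulrDr.
have tr c : \sum_q \sum_r invmx (g x) q r * part c (g x) q r = 2.
  rewrite -(sum_in_block R c); apply: eq_bigr => q _.
  by rewrite (invmx_part (nariai_diag_neq0 Dx)) eqxx mul1r.
rewrite -{1}(tr true) -(tr false) !mulr_suml -big_split /=.
apply: eq_bigr => q _; rewrite !mulr_suml -big_split /=; apply: eq_bigr => r _.
have -> : (k1 x *: part true (g x) + k2 x *: part false (g x)) q r
  = k1 x * part true (g x) q r + k2 x * part false (g x) q r by rewrite !mxE.
by ring.
Qed.

Lemma metric_parts x i j : g x i j = part true (g x) i j + part false (g x) i j.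
Proof. by rewrite -{1}(part_add (g x)) mxE. Qed.

Lemma ricci_parts x i j : D x ->
  ricci g x i j = k1 x * part true (g x) i j + k2 x * part false (g x) i j.
Proof. by move=> /nariai_ricci ->; rewrite !mxE. Qed.

(** The factor c such that the conformal curvature is
    c (E wedge E - E wedge F + F wedge F). *)
Definition weyl_factor (x : 'rV[R]_4) : R := 6^-1 * (k1 x + k2 x).

Lemma nariai_conformal x : D x ->
  conformal g x = let c := weyl_factor x in
                  block_tensor (g x) (2 * c) (2 * c) (- c) (- c).
Proof.
move=> Dx; apply/funext => p; apply/funext => q; apply/funext => r; apply/funext => s.
rewrite /conformal nariai_riemann // nariai_scalar_curvature // !ricci_parts //.
by rewrite !metric_parts /weyl_factor /block_tensor; field.
Qed.

Lemma nariai_projective x : D x ->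
  projective g x = block_tensor (g x) (2 / 3 * k1 x) (2 / 3 * k2 x)
                                (- (3^-1 * k2 x)) (- (3^-1 * k1 x)).
Proof.
move=> Dx; apply/funext => p; apply/funext => q; apply/funext => r; apply/funext => s.
rewrite /projective nariai_riemann // !ricci_parts //.
by rewrite !metric_parts /block_tensor; field.
Qed.

Lemma nariai_concircular x : D x ->
  concircular g x = let w := weyl_factor x in
    block_tensor (g x) (k1 x - w) (k2 x - w) (- w) (- w).
Proof.
move=> Dx; apply/funext => p; apply/funext => q; apply/funext => r; apply/funext => s.
rewrite /concircular nariai_riemann // nariai_scalar_curvature //.
by rewrite !metric_parts /weyl_factor /block_tensor; field.
Qed.

Lemma kulkarni_nomizu_gg x : kulkarni_nomizu (g x) (g x) = block_tensor (g x) 2 2 2 2.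
Proof.
apply/funext => p; apply/funext => q; apply/funext => r; apply/funext => s.
by rewrite /kulkarni_nomizu /block_tensor !metric_parts; ring.
Qed.

Lemma kulkarni_nomizu_gS x : D x ->
  kulkarni_nomizu (g x) (ricci g x)
  = block_tensor (g x) (2 * k1 x) (2 * k2 x) (k1 x + k2 x) (k1 x + k2 x).
Proof.
move=> Dx; apply/funext => p; apply/funext => q; apply/funext => r; apply/funext => s.
by rewrite /kulkarni_nomizu /block_tensor !ricci_parts // !metric_parts; ring.
Qed.

Lemma kulkarni_nomizu_SS x : D x ->
  kulkarni_nomizu (ricci g x) (ricci g x)
  = block_tensor (g x) (2 * k1 x ^+ 2) (2 * k2 x ^+ 2)
                 (2 * k1 x * k2 x) (2 * k1 x * k2 x).
Proof.
move=> Dx; apply/funext => p; apply/funext => q; apply/funext => r; apply/funext => s.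
by rewrite /kulkarni_nomizu /block_tensor !ricci_parts //; ring.
Qed.

(** * Covariant derivatives of block tensors *)

Lemma part_differentiable c i j x : D x -> differentiable (fun y => part c (g y) i j) x.
Proof.
move=> Dx; rewrite (_ : (fun y => _) = (fun y => in_block R c i * g y i j)); last first.
  by apply/funext => y; rewrite !mxE.
apply: differentiableM => //.
exact: (smooth_on_differentiable (metric_smooth i j)).
Qed.

(** The metric of each factor is parallel, because the Levi-Civita connection of
    a product is the product connection. *)
Lemma part_parallel c a i j x : D x ->
  partial a (fun y => part c (g y) i j) x
  = \sum_t (christoffel g t a i x * part c (g x) t j
            + christoffel g t a j x * part c (g x) i t).
Proof.
move=> Dx; rewrite (_ : (fun y => _) = (fun y => in_block R c i * g y i j)); last first.
  by apply/funext => y; rewrite !mxE.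
rewrite partialM //; last exact: (smooth_on_differentiable (metric_smooth i j)).
rewrite partial_cst mulr0 addr0 partial_metric //.
under eq_bigr do rewrite !nariai_christoffel // ![part _ _ _ _]mxE !nariai_entry.
rewrite /gamma_t /gamma_r /gamma_phi /gamma_theta !big_ord_recl big_ord0 -!val_eqE.
have [/xi_neq0 x0 /h_neq0 hx0] := Dx; rewrite /in_block.
elim/ord4_ind: a; elim/ord4_ind: i; elim/ord4_ind: j; case: c;
  rewrite /gamma /metric_partial /metric_entry /bump /=;
  first [ring | by field; rewrite ?x0 ?hx0].
Qed.

(** The covariant derivative at x depends on the germ of T only, which allows
    replacing curvature tensors by their expressions on the chart. *)
Lemma nabla_eq T T' x a p q r s : {in D, T =1 T'} -> D x ->
  nabla g T x a p q r s = nabla g T' x a p q r s.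
Proof.
move=> TT' Dx; rewrite /nabla (TT' x (mem_set Dx)); congr (_ - _).
apply: (partial_eq_on open_chart); last exact: mem_set.
by move=> y Dy; rewrite TT'.
Qed.

(** One of the four generators of the block tensors, k and l selecting the
    factors. *)
Definition wedge (x : 'rV[R]_4) k l : tensor4 R := fun p q r s =>
  part k (g x) p s * part l (g x) q r - part k (g x) q s * part l (g x) p r.

Lemma scaled_wedge_differentiable (f : 'rV[R]_4 -> R) k l x p q r s :
  D x -> differentiable f x ->
  differentiable (fun y => f y * wedge y k l p q r s) x.
Proof.
move=> Dx df; apply: differentiableM => //.
by apply: differentiableB; apply: differentiableM; apply: part_differentiable.
Qed.

(** The Leibniz rule: the parts of g are parallel, so the derivative of a
    generator is given by the connection terms alone. *)
Lemma partial_scaled_wedge (f : 'rV[R]_4 -> R) k l x a p q r s :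
  D x -> differentiable f x ->
  partial a (fun y => f y * wedge y k l p q r s) x
  = partial a f x * wedge x k l p q r s
    + \sum_t f x * (christoffel g t a p x * wedge x k l t q r s
                    + christoffel g t a q x * wedge x k l p t r s
                    + christoffel g t a r x * wedge x k l p q t s
                    + christoffel g t a s x * wedge x k l p q r t).
Proof.
move=> Dx df.
have dp m u v : differentiable (fun y => part m (g y) u v) x.
  exact: part_differentiable.
have dpp u v u' v' :
    differentiable (fun y => part k (g y) u v * part l (g y) u' v') x.
  exact: differentiableM.
rewrite partialM //; last exact: differentiableB.
rewrite (partialB a (dpp p s q r) (dpp q s p r)) !partialM // !part_parallel //.
rewrite [LHS]addrC [wedge _ _ _ _ _ _ _ * _]mulrC; congr (_ + _).
rewrite !mulr_sumr -!big_split -sumrB mulr_sumr /=; apply: eq_bigr => t _.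
by rewrite /wedge; ring.
Qed.

Lemma nabla_block (a b c e : 'rV[R]_4 -> R) x i p q r s :
  D x -> differentiable a x -> differentiable b x -> differentiable c x ->
  differentiable e x ->
  nabla g (fun y => block_tensor (g y) (a y) (b y) (c y) (e y)) x i p q r s
  = block_tensor (g x) (partial i a x) (partial i b x) (partial i c x)
                 (partial i e x) p q r s.
Proof.
move=> Dx da db dc de; rewrite /nabla.
have term (f : 'rV[R]_4 -> R) k l : differentiable f x ->
    differentiable (fun y => f y * wedge y k l p q r s) x.
  exact: scaled_wedge_differentiable.
have bt a' b' c' e' p' q' r' s' : block_tensor (g x) a' b' c' e' p' q' r' s'
   = a' * wedge x true true p' q' r' s' + b' * wedge x false false p' q' r' s'
     + c' * wedge x true false p' q' r' s' + e' * wedge x false true p' q' r' s' by [].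
rewrite [partial i (fun y => _) x](_ : _ =
   partial i (fun y => a y * wedge y true true p q r s) x
   + partial i (fun y => b y * wedge y false false p q r s) x
   + partial i (fun y => c y * wedge y true false p q r s) x
   + partial i (fun y => e y * wedge y false true p q r s) x); last first.
  have [dwa dwb dwc dwe] :=
    And4 (term _ true true da) (term _ false false db)
         (term _ true false dc) (term _ false true de).
  rewrite -(partialD i dwa dwb) -(partialD i (differentiableD dwa dwb) dwc).
  by rewrite -(partialD i (differentiableD (differentiableD dwa dwb) dwc) dwe).
(* The connection terms of one generator, summed over t in the covariant
   derivative. *)
pose gW k l t := christoffel g t i p x * wedge x k l t q r s
  + christoffel g t i q x * wedge x k l p t r s
  + christoffel g t i r x * wedge x k l p q t s
  + christoffel g t i s x * wedge x k l p q r t.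
have leibniz (f : 'rV[R]_4 -> R) k l : differentiable f x ->
    partial i (fun y => f y * wedge y k l p q r s) x
    = partial i f x * wedge x k l p q r s + \sum_t f x * gW k l t.
  exact: partial_scaled_wedge.
rewrite !leibniz // bt [X in _ - X](_ : _ =
  \sum_t a x * gW true true t + \sum_t b x * gW false false t
  + \sum_t c x * gW true false t + \sum_t e x * gW false true t); first by ring.
by rewrite -!big_split /=; apply: eq_bigr => t _; rewrite !bt /gW; ring.
Qed.

(** * Smoothness and degeneracy of the Ricci eigenvalues *)

Lemma tr_curvature_smooth : smooth_on D k1.
Proof.
have oD := open_chart.
have s2 : smooth_on D (fun y => xi2 (y 0 ir)).
  apply: (smooth_on_coord oD (I := I)) => [x []//|].
  by apply: smooth_on1_derive1; apply: smooth_on1_derive1.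
apply: (smooth_onM oD s2); apply: smooth_onV_neq0 => //.
  by apply: (smooth_onM oD (smooth_on_cst oD A)); exact: xi_coord_smooth.
by move=> x [/xi_neq0 x0 _]; rewrite mulf_neq0.
Qed.

Lemma angular_curvature_smooth : smooth_on D k2.
Proof.
have oD := open_chart.
have s2 : smooth_on D (fun y => h2 (y 0 itheta)).
  apply: (smooth_on_coord oD (I := J)) => [x []//|].
  by apply: smooth_on1_derive1; apply: smooth_on1_derive1.
apply: (smooth_onM oD s2); apply: smooth_onV_neq0 => //.
  by apply: (smooth_onM oD (smooth_on_cst oD B)); exact: h_coord_smooth.
by move=> x [_ /h_neq0 x0]; rewrite mulf_neq0.
Qed.

Lemma partial_tr_curvature a x : a != ir -> partial a k1 x = 0.
Proof.
by move=> /negPf ai; rewrite /k1 /tr_curvature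
  (partial_coord a ir (fun r => xi2 r / (A * xi r))) ai mul0r.
Qed.

Lemma partial_angular_curvature a x : a != itheta -> partial a k2 x = 0.
Proof.
by move=> /negPf ai; rewrite /k2 /angular_curvature
  (partial_coord a itheta (fun r => h2 r / (B * h r))) ai mul0r.
Qed.

(** A function of r that equals a function of theta is constant. *)
Lemma equal_curvatures_partial a x : (\near x, k1 x = k2 x) ->
  partial a k1 x = 0 /\ partial a k2 x = 0.
Proof.
move=> k12; have e : partial a k1 x = partial a k2 x by apply: near_eq_derive.
have [ar|ar] := eqVneq a ir; first by rewrite e partial_angular_curvature // ar.
by rewrite -e partial_tr_curvature.
Qed.

Lemma weyl_factor_smooth : smooth_on D weyl_factor.
Proof.
have oD := open_chart; apply: (smooth_onM oD); first exact: smooth_on_cst.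
by apply: (smooth_onD oD); [exact: tr_curvature_smooth|exact: angular_curvature_smooth].
Qed.

Lemma tracefree_eq0 x : D x -> (tracefree_ricci g x == 0) = (k1 x == k2 x).
Proof.
move=> Dx.
have tfE i j : tracefree_ricci g x i j
    = (k1 x - k2 x) / 2 * (part true (g x) i j - part false (g x) i j).
  have -> : tracefree_ricci g x i j
      = ricci g x i j - scalar_curvature g x / 4 * g x i j by rewrite !mxE.
  by rewrite ricci_parts // nariai_scalar_curvature // metric_parts; field.
apply/eqP/eqP => [tf0|k12]; last first.
  by apply/matrixP => i j; rewrite tfE k12 subrr !mul0r mxE.
have := tfE ord0 ord0; rewrite tf0 !mxE /in_block /= mulr1n mul1r mul0r subr0.
move=> /esym/eqP; rewrite !mulf_eq0 invr_eq0 pnatr_eq0 orbF.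
have := nariai_diag_neq0 Dx ord0; rewrite !mxE => /negPf; rewrite /= => ->.
by rewrite orbF subr_eq0 => /eqP.
Qed.

Lemma nariai_ricci_diag x : D x ->
  ricci g x = diag_mx (\row_i ((k1 x * in_block R true i + k2 x * in_block R false i)
                               * d x 0 i)).
Proof.
move=> Dx; apply/matrixP => i j; rewrite ricci_parts // !mxE.
by case: (i == j); rewrite ?mulr1n ?mulr0n; ring.
Qed.

(** The rank of S enters only through the dichotomy between rank 4 and smaller
    rank. *)
Lemma ricci_unit x : D x -> (ricci g x \in unitmx) = (k1 x != 0) && (k2 x != 0).
Proof.
move=> Dx; rewrite nariai_ricci_diag // unitmxE det_diag unitfE.
pose k i := k1 x * in_block R true i + k2 x * in_block R false i.
have entry i : (\row_j (k j * d x 0 j)) 0 i != 0 = (k i != 0).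
  by rewrite mxE mulf_eq0 (negPf (nariai_diag_neq0 Dx i)) orbF.
apply/prodf_neq0/andP => [nz|[k1x k2x] i _].
  have := nz itheta isT; have := nz ord0 isT; rewrite !entry /k /in_block /=.
  by rewrite !mulr1 !mulr0 addr0 add0r.
rewrite entry /k /in_block.
by case: (i < 2)%N; rewrite /= mulr1 mulr0 ?addr0 ?add0r.
Qed.

Lemma open_non_einstein : open (non_einstein g D).
Proof.
rewrite openE => x [Dx tfx]; rewrite /interior.
have Dn : nbhs x D by apply: open_nbhs_nbhs; split => //; exact: open_chart.
have d12 : differentiable (fun y => k1 y - k2 y) x.
  by apply: differentiableB; apply: smooth_on_differentiable Dx;
    [exact: tr_curvature_smooth|exact: angular_curvature_smooth].
have k12 : k1 x - k2 x != 0 by rewrite subr_eq0 -tracefree_eq0.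
apply: filterS2 Dn (near_neq0 d12 k12) => y Dy; rewrite subr_eq0 => ky.
by split; rewrite // tracefree_eq0.
Qed.

(** The trace-free Ricci tensor is (k1 - k2)/2 (E - F), of rank 0 exactly where
    k1 = k2. *)
Lemma tracefree_steady :
  steady_zeros (tracefree_regular g D) (fun x => k1 x - k2 x).
Proof.
move=> x [Dx rk]; rewrite subr_eq0; have [k12|] := eqVneq (k1 x) (k2 x); last by left.
right; have Dn : nbhs x D by apply: open_nbhs_nbhs; split => //; exact: open_chart.
apply: filterS2 Dn rk => y Dy rky; apply/eqP; rewrite subr_eq0 -tracefree_eq0 //.
by rewrite -mxrank_eq0 rky mxrank_eq0 tracefree_eq0 // k12.
Qed.

(** If k1 vanishes at x then S is degenerate near x, that is k1 k2 = 0.  Near x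
    either k1 = k2, or k2 has no zero; in both cases k1 = 0. *)
Lemma ricci_steady :
  steady_zeros (ricci_regular g D) k1 /\ steady_zeros (ricci_regular g D) k2.
Proof.
suff st x : ricci_regular g D x ->
    (k1 x != 0 \/ \near x, k1 x = 0) /\ (k2 x != 0 \/ \near x, k2 x = 0).
  by split=> x /st[].
move=> [tfx [Dx rk]].
have Dn : nbhs x D by apply: open_nbhs_nbhs; split => //; exact: open_chart.
have degenerate : ~~ ((k1 x != 0) && (k2 x != 0)) ->
    \near x, ~~ ((k1 x != 0) && (k2 x != 0)).
  rewrite -(ricci_unit Dx) -row_free_unit /row_free => rx.
  apply: filterS2 Dn rk => y Dy rky.
  by rewrite -(ricci_unit Dy) -row_free_unit /row_free rky.
have d1 := near_neq0 (smooth_on_differentiable tr_curvature_smooth Dx).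
have d2 := near_neq0 (smooth_on_differentiable angular_curvature_smooth Dx).
have [k12|k12] := tracefree_steady tfx; last first.
  by split; [have [z|] := eqVneq (k1 x) 0|have [z|] := eqVneq (k2 x) 0];
    try (by left); right; (have dg : ~~ ((k1 x != 0) && (k2 x != 0))
      by rewrite z eqxx ?andbF);
    apply: filterS2 k12 (degenerate dg) => y /eqP; rewrite subr_eq0 => /eqP ->;
    rewrite andbb negbK => /eqP.
split.
  have [z|] := eqVneq (k1 x) 0; last by left.
  right; have k2x : k2 x != 0 by move: k12; rewrite z sub0r oppr_eq0.
  have dg : ~~ ((k1 x != 0) && (k2 x != 0)) by rewrite z eqxx.
  by apply: filterS2 (d2 k2x) (degenerate dg) => y ->; rewrite andbT negbK => /eqP.
have [z|] := eqVneq (k2 x) 0; last by left.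
right; have k1x : k1 x != 0 by move: k12; rewrite z subr0.
have dg : ~~ ((k1 x != 0) && (k2 x != 0)) by rewrite z eqxx andbF.
by apply: filterS2 (d1 k1x) (degenerate dg) => y ->; rewrite negbK => /eqP.
Qed.

(** The component C_0110 is 2 c g_00 g_11. *)
Lemma conformal_eq0 x : D x ->
  (forall p q r s, conformal g x p q r s = 0) <-> weyl_factor x = 0.
Proof.
move=> Dx; rewrite nariai_conformal //; split=> [c0|-> p q r s]; last first.
  by rewrite /block_tensor; ring.
have entry k (i j : 'I_4) : part k (g x) i j = in_block R k i * (d x 0 i *+ (i == j)).
  by rewrite mxE mxE.
have := c0 ord0 ir ir ord0; rewrite /block_tensor !entry /in_block -!val_eqE /=.
set d0 := metric_diagonal x 0 ord0; set d1 := metric_diagonal x 0 ir.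
move: (weyl_factor x) => w tr.
have /eqP : 2 * w * (d0 * d1) = 0 by rewrite -[RHS]tr; ring.
rewrite !mulf_eq0 pnatr_eq0 /d0 /d1 !(negPf (nariai_diag_neq0 Dx _)) /= !orbF.
by move=> /eqP.
Qed.

Lemma conformal_steady : steady_zeros (conformal_regular g D) weyl_factor.
Proof.
move=> x [Dx cx]; have [z|] := eqVneq (weyl_factor x) 0; last by left.
right; have Dn : nbhs x D by apply: open_nbhs_nbhs; split => //; exact: open_chart.
apply: filterS2 Dn cx => y Dy cy; apply/(conformal_eq0 Dy).
apply/asboolP; rewrite cy; apply/asboolP.
exact/(conformal_eq0 Dx).
Qed.

(** * The algebraic curvature conditions *)

(** S - k1 g = (k2 - k1) F, and F is degenerate exactly along the first
    factor. *)
Lemma nariai_two_quasi_einstein : two_quasi_einstein g (non_einstein g D).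
Proof.
exists k1; split=> [|x [Dx]].
  by apply: (smooth_on_subset _ tr_curvature_smooth) => x [].
rewrite tracefree_eq0 // => k12.
have -> : ricci g x - k1 x *: g x = (k2 x - k1 x) *: (copid_mx 2 *m g x).
  apply/matrixP => i j.
  have -> : (ricci g x - k1 x *: g x) i j = ricci g x i j - k1 x * g x i j.
    by rewrite !mxE.
  rewrite ricci_parts // metric_parts.
  have -> : ((k2 x - k1 x) *: (copid_mx 2 *m g x)) i j
      = (k2 x - k1 x) * part false (g x) i j.
    rewrite mxE; congr (_ * _).
    rewrite mul_mx_diag mxE [part _ _ _ _]mxE nariai_entry.
    rewrite /copid_mx !mxE -val_eqE /in_block; have
      [/val_inj->|_] := eqVneq (val i) (val j).
      by rewrite /= !mulr1n; case: (j < 2)%N; rewrite /= ?subrr ?subr0.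
    by rewrite /= subrr mul0r mulr0.
  by ring.
rewrite mxrank_scale_nz; last by rewrite subr_eq0 eq_sym.
rewrite mxrankMfree; last first.
  rewrite row_free_unit unitmxE det_diag unitfE; apply/prodf_neq0 => i _.
  exact: nariai_diag_neq0.
by rewrite rank_copid_mx.
Qed.

(** S = k2 g + (k1 - k2) E, and the Lorentzian form E is a multiple of the
    product of the null forms xi dt - dr and xi dt + dr; a definite form such
    as F has no such factorization over the reals. *)
Lemma nariai_generalized_quasi_einstein : generalized_quasi_einstein g D.
Proof.
have oD := open_chart.
exists k2, (fun=> 0), (fun x => - (A / 2) * (k1 x - k2 x)).
exists (fun x => \row_(i < 4) nth 0 [:: xi (x 0 ir); -1] i).
exists (fun x => \row_(i < 4) nth 0 [:: xi (x 0 ir); 1] i).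
have sk1 := tr_curvature_smooth; have sk2 := angular_curvature_smooth.
have sxi := xi_coord_smooth.
split; [split=> //|split; [split|]].
- exact: smooth_on_cst.
- by apply: smooth_onM => //; [exact: smooth_on_cst|exact: smooth_onB].
- by apply: smooth_form_row => //; elim/ord4_ind => //=; exact: smooth_on_cst.
- by apply: smooth_form_row => //; elim/ord4_ind => //=; exact: smooth_on_cst.
move=> x Dx i j; rewrite ricci_parts // metric_parts.
have entry k : part k (g x) i j
    = in_block R k i * (metric_entry A B (xi (x 0 ir)) (h (x 0 itheta)) i *+ (i == j)).
  by rewrite mxE nariai_entry.
rewrite !entry !mxE /in_block -!val_eqE.
by elim/ord4_ind: i {entry}; elim/ord4_ind: j; rewrite /metric_entry /=; field.
Qed.

(** Where k1 and k2 differ, E = (S - k2 g)/(k1 - k2) and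
    F = (k1 g - S)/(k1 - k2); the coefficients arise by expanding
    k1/2 (E wedge E) + k2/2 (F wedge F). *)
Lemma nariai_roter_type : roter_type g (non_einstein g D).
Proof.
have oU := open_non_einstein; set U := non_einstein g D in oU *.
have UD : U `<=` D by move=> x [].
have sk1 := smooth_on_subset UD tr_curvature_smooth.
have sk2 := smooth_on_subset UD angular_curvature_smooth.
have k12 x : U x -> k1 x - k2 x != 0.
  by move=> [Dx]; rewrite tracefree_eq0 // subr_eq0.
have s12 : smooth_on U (fun x => ((k1 x - k2 x) ^+ 2)^-1).
  apply: smooth_onV_neq0 => //; first by apply: smooth_onX => //; exact: smooth_onB.
  by move=> x Ux; rewrite expf_neq0 // k12.
exists (fun x => 2^-1 * (k1 x * k2 x * (k1 x + k2 x)) * ((k1 x - k2 x) ^+ 2)^-1).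
exists (fun x => - 2 * (k1 x * k2 x) * ((k1 x - k2 x) ^+ 2)^-1).
exists (fun x => 2^-1 * (k1 x + k2 x) * ((k1 x - k2 x) ^+ 2)^-1).
split.
  by split; do ?[exact: sk1 | exact: sk2 | exact: s12 | exact: smooth_on_cst
    | apply: smooth_onM | apply: smooth_onD] => //.
move=> x Ux p q r s; have Dx := UD _ Ux.
rewrite nariai_riemann // kulkarni_nomizu_gg kulkarni_nomizu_gS //.
rewrite kulkarni_nomizu_SS //.
move: (k12 x Ux); rewrite /block_tensor.
move: (k1 x) (k2 x) => l1 l2 l12.
by field.
Qed.

(** * The recurrence conditions *)

(** Comparing the coefficients of the four generators.  The numbers multiplying
    the 1-forms are the coefficients of S wedge S, g wedge S and g wedge g. *)
Lemma sgk_block (T : 'rV[R]_4 -> tensor4 R) (a b c e : 'rV[R]_4 -> R)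
    (U : set 'rV[R]_4) (Pi Phi Psi Theta : one_form R) :
  (forall x, D x -> T x = block_tensor (g x) (a x) (b x) (c x) (e x)) ->
  [/\ smooth_on D a, smooth_on D b, smooth_on D c & smooth_on D e] ->
  U `<=` D ->
  [/\ smooth_form U Pi, smooth_form U Phi, smooth_form U Psi & smooth_form U Theta] ->
  (forall x, U x -> forall i,
    [/\ partial i a x = Pi x 0 i * a x + Phi x 0 i * (2 * k1 x ^+ 2)
                        + Psi x 0 i * (2 * k1 x) + Theta x 0 i * 2,
        partial i b x = Pi x 0 i * b x + Phi x 0 i * (2 * k2 x ^+ 2)
                        + Psi x 0 i * (2 * k2 x) + Theta x 0 i * 2,
        partial i c x = Pi x 0 i * c x + Phi x 0 i * (2 * k1 x * k2 x)
                        + Psi x 0 i * (k1 x + k2 x) + Theta x 0 i * 2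
      & partial i e x = Pi x 0 i * e x + Phi x 0 i * (2 * k1 x * k2 x)
                        + Psi x 0 i * (k1 x + k2 x) + Theta x 0 i * 2]) ->
  sgk_with g T U Pi Phi Psi Theta.
Proof.
move=> TE [sa sb sc se] UD sF coef; split=> // x Ux i p q r s.
have Dx := UD _ Ux.
have TT : {in D, T =1 fun y => block_tensor (g y) (a y) (b y) (c y) (e y)}.
  by move=> y /set_mem Dy; rewrite TE.
rewrite (nabla_eq _ _ _ _ _ TT Dx) nabla_block //;
  try exact: smooth_on_differentiable Dx.
rewrite kulkarni_nomizu_gg kulkarni_nomizu_gS // kulkarni_nomizu_SS // TE //.
by have [-> -> -> ->] := coef x Ux i; rewrite /block_tensor; ring.
Qed.

Lemma nariai_semisymmetric : semisymmetric g D.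
Proof.
move=> x Dx p1 p2 p3 p4 r s; rewrite nariai_riemann //.
rewrite (tdot_block (nariai_diag_neq0 Dx)) //.
by rewrite !mul0r addr0 oppr0.
Qed.

(** The mixed coefficients of C are - c, those of the identity curvature
    operator g wedge g / 2 are 1, and the latter acts on R as - Q(g, R). *)
Lemma nariai_conformally_pseudosymmetric : conformally_pseudosymmetric g D.
Proof.
exists weyl_factor; split=> [|x Dx p1 p2 p3 p4 r s].
  by apply: (smooth_on_subset _ weyl_factor_smooth) => x [].
rewrite nariai_riemann // nariai_conformal // (tdot_block (nariai_diag_neq0 Dx)) //.
by rewrite (tachibana_block (metric_diagonal x)); ring.
Qed.

Lemma nariai_riemann_compatible : ricci_compatible g (riemann g) D.
Proof.
move=> x Dx p q r s; rewrite /ricci_up nariai_ricci // nariai_riemann //.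
exact: (block_compatible (nariai_diag_neq0 Dx)).
Qed.

Lemma nariai_projective_compatible : ricci_compatible g (projective g) D.
Proof.
move=> x Dx p q r s; rewrite /ricci_up nariai_ricci // nariai_projective //.
exact: (block_compatible (nariai_diag_neq0 Dx)).
Qed.

Lemma steady_difference a x : tracefree_regular g D x -> k1 x = k2 x ->
  partial a k1 x = 0 /\ partial a k2 x = 0.
Proof.
move=> tfx k12; apply: equal_curvatures_partial.
have [|k0] := tracefree_steady tfx; first by rewrite k12 subrr eqxx.
by apply: filterS k0 => y /eqP; rewrite subr_eq0 => /eqP.
Qed.

(** The forms Pi and Phi of the special SGK condition: they solve
    Pi + 2 Phi (k1 - k2) = d log k1 and Pi - 2 Phi (k1 - k2) = d log k2, where
    Theta = - k1 k2 Phi has been eliminated from the mixed coefficient. *)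
Definition mean_log_derivative (a : 'I_4) (x : 'rV[R]_4) : R :=
  2^-1 * (partial a k1 x * (k1 x)^-1 + partial a k2 x * (k2 x)^-1).

Definition log_derivative_slope (a : 'I_4) (x : 'rV[R]_4) : R :=
  4^-1 * (partial a k1 x * (k1 x)^-1 - partial a k2 x * (k2 x)^-1)
  * (k1 x - k2 x)^-1.

(** The equations for Pi and Phi, multiplied by k1 and k2 so as to hold
    without exception: if k1 = 0 then dk1 = 0 and the first equation is trivial,
    while the second reads dk2 = dk2/2 + dk2/2. *)
Lemma log_derivative_identities a x : ricci_regular g D x ->
  let d1 := partial a k1 x in let d2 := partial a k2 x in
  let pi := mean_log_derivative a x in let phi := log_derivative_slope a x in
  d1 = pi * k1 x + 2 * phi * k1 x * (k1 x - k2 x)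
  /\ d2 = pi * k2 x - 2 * phi * k2 x * (k1 x - k2 x).
Proof.
move=> Ux; have [tfx _] := Ux; have [st1 st2] := ricci_steady.
have z1 := steady_partial a st1 Ux; have z2 := steady_partial a st2 Ux.
have z12 := steady_difference a tfx.
rewrite /= /mean_log_derivative /log_derivative_slope.
move: (partial a k1 x) (partial a k2 x) (k1 x) (k2 x) z1 z2 z12.
move=> d1 d2 l1 l2 z1 z2 z12.
have [l12|l12] := eqVneq l1 l2.
  by have [-> ->] := z12 l12; rewrite !mul0r; split; ring.
have {}l12 : l1 - l2 != 0 by rewrite subr_eq0.
have [l10|l10] := eqVneq l1 0.
  rewrite (z1 l10) l10 sub0r in l12 *; rewrite oppr_eq0 in l12.
  by split; [rewrite !(mul0r, mulr0); ring | rewrite mul0r sub0r; field].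
have [l20|l20] := eqVneq l2 0.
  rewrite (z2 l20) l20 subr0 in l12 *.
  by split; [rewrite mul0r addr0 subr0; field | rewrite !(mul0r, mulr0); ring].
by split; field; rewrite ?l12 ?l10 ?l20.
Qed.

Lemma ricci_coefficients_smooth (U : set 'rV[R]_4) a :
  open U -> U `<=` D ->
  steady_zeros U k1 -> steady_zeros U k2 -> steady_zeros U (fun x => k1 x - k2 x) ->
  smooth_on U (mean_log_derivative a) /\ smooth_on U (log_derivative_slope a).
Proof.
move=> openU UD st1 st2 st12.
have s1 := smooth_on_subset UD tr_curvature_smooth.
have s2 := smooth_on_subset UD angular_curvature_smooth.
have v1 := smooth_onV openU s1 st1; have v2 := smooth_onV openU s2 st2.
have v12 := smooth_onV openU (smooth_onB openU s1 s2) st12.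
have d1 := smooth_on_partial a s1; have d2 := smooth_on_partial a s2.
by split; do ?[exact: d1 | exact: d2 | exact: v1 | exact: v2 | exact: v12
  | exact: smooth_on_cst | apply: smooth_onM | apply: smooth_onB
  | apply: smooth_onD] => //.
Qed.

Lemma open_tracefree_regular : open (tracefree_regular g D).
Proof. exact/open_locally_constant_part/open_chart. Qed.

Lemma open_ricci_regular : open (ricci_regular g D).
Proof.
by apply: topology_structure.openI; exact/open_locally_constant_part/open_chart.
Qed.

Lemma nariai_riemann_special_sgk :
  special_super_generalized_recurrent g (riemann g) (ricci_regular g D).
Proof.
set U := ricci_regular g D; have oU : open U := open_ricci_regular.
have UD : U `<=` D by move=> x [[]].
have sk1 := tr_curvature_smooth; have sk2 := angular_curvature_smooth.
have c0 := smooth_on_cst open_chart 0.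
have [st1 st2] := ricci_steady.
have st12 : steady_zeros U (fun x => k1 x - k2 x) by move=> x [/tracefree_steady].
have s12 i := ricci_coefficients_smooth i oU UD st1 st2 st12.
exists (fun x => \row_i mean_log_derivative i x).
exists (fun x => \row_i log_derivative_slope i x).
exists (fun x => \row_i - (log_derivative_slope i x * (k1 x * k2 x))).
apply: (sgk_block nariai_riemann) => //.
- split; [| |exact: smooth_form0|]; apply: smooth_form_row => // i;
    try exact: (s12 i).1; try exact: (s12 i).2.
  apply: smooth_onN => //; apply: smooth_onM => //; first exact: (s12 i).2.
  by apply: smooth_onM => //; apply: (smooth_on_subset UD).
move=> x Ux i; rewrite !mxE partial_cst; have [e1 e2] := log_derivative_identities i Ux.
split; [rewrite [LHS]e1|rewrite [LHS]e2| |]; ring.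
Qed.

(** The coefficients - k2/3 and - k1/3 of the two halves of E wedge F force
    Pi = d log (k1 - k2).  The defect dk1 - Pi k1 = dk2 - Pi k2 is the quantity
    det below, and the remaining three coefficients determine Phi, Psi and
    Theta through a linear system whose determinant is a multiple of (k1 - k2)^3. *)
Lemma nariai_projective_sgk :
  super_generalized_recurrent g (projective g) (tracefree_regular g D).
Proof.
set U := tracefree_regular g D; have oU : open U := open_tracefree_regular.
have UD : U `<=` D by move=> x [].
have sD1 := tr_curvature_smooth; have sD2 := angular_curvature_smooth.
have sk1 := smooth_on_subset UD sD1; have sk2 := smooth_on_subset UD sD2.
have v12 := smooth_onV oU (smooth_onB oU sk1 sk2) tracefree_steady.
have d1 i := smooth_on_partial i sk1; have d2 i := smooth_on_partial i sk2.
pose pi i x := (partial i k1 x - partial i k2 x) * (k1 x - k2 x)^-1.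
pose det i x := (k1 x * partial i k2 x - partial i k1 x * k2 x) * (k1 x - k2 x)^-1.
pose phi i x := det i x * ((k1 x - k2 x)^-1 * (k1 x - k2 x)^-1).
exists (fun x => \row_i pi i x), (fun x => \row_i phi i x).
exists (fun x => \row_i - (phi i x * (k1 x + k2 x))).
exists (fun x => \row_i (3^-1 * det i x + phi i x * (k1 x * k2 x))).
apply: (sgk_block nariai_projective) => //.
- have oD := open_chart.
  by split; do ?[exact: sD1 | exact: sD2 | exact: smooth_on_cst
    | apply: smooth_onN | apply: smooth_onM] => //.
(* For arbitrary functions, so that the search does not unfold k1 and k2. *)
- have forms (f1 f2 e1 e2 v : 'rV[R]_4 -> R) :
      smooth_on U f1 -> smooth_on U f2 -> smooth_on U e1 -> smooth_on U e2 ->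
      smooth_on U v ->
      let det x := (f1 x * e2 x - e1 x * f2 x) * v x in
      let phi x := det x * (v x * v x) in
      [/\ smooth_on U (fun x => (e1 x - e2 x) * v x), smooth_on U phi,
          smooth_on U (fun x => - (phi x * (f1 x + f2 x)))
        & smooth_on U (fun x => 3^-1 * det x + phi x * (f1 x * f2 x))].
    by move=> sf1 sf2 se1 se2 sv; split;
      do ?[exact: sf1 | exact: sf2 | exact: se1 | exact: se2 | exact: sv
        | exact: smooth_on_cst | apply: smooth_onM | apply: smooth_onN
        | apply: smooth_onD] => //.
  have smooth_forms i := forms _ _ _ _ _ sk1 sk2 (d1 i) (d2 i) v12.
  by split; apply: smooth_form_row => // i; have [] := smooth_forms i.
move=> x Ux i; have Dx := UD _ Ux.
have df1 := smooth_on_differentiable sD1 Dx.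
have df2 := smooth_on_differentiable sD2 Dx.
have scale (c : R) f : differentiable f x ->
    partial i (fun y => c * f y) x = c * partial i f x.
  by move=> df; rewrite partialM // partial_cst mulr0 addr0.
have scaleN (c : R) f : differentiable f x ->
    partial i (fun y => - (c * f y)) x = - (c * partial i f x).
  move=> df; rewrite -[RHS]mulNr -scale //; congr (partial _ _ x).
  by apply/funext => y; rewrite mulNr.
rewrite !mxE !scale // !scaleN //.
have := steady_difference i Ux; rewrite /phi /det /pi.
move: (partial i k1 x) (partial i k2 x) (k1 x) (k2 x) => e1 e2 l1 l2 z12.
have [l12|l12] := eqVneq l1 l2; first by have [-> ->] := z12 l12; split; ring.
have {}l12 : l1 - l2 != 0 by rewrite subr_eq0.
by split; field.
Qed.

(** C is c times a parallel tensor, so Pi = d log c. *)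
Lemma nariai_conformal_recurrent : recurrent g (conformal g) (conformal_regular g D).
Proof.
set U := conformal_regular g D.
have oU : open U by exact/open_locally_constant_part/open_chart.
have UD : U `<=` D by move=> x [].
have sw := weyl_factor_smooth; have oD := open_chart.
have vw := smooth_onV oU (smooth_on_subset UD sw) conformal_steady.
exists (fun x => \row_i (partial i weyl_factor x * (weyl_factor x)^-1)).
apply: (sgk_block nariai_conformal) => //.
- by split; do ?[exact: sw | exact: smooth_on_cst | apply: smooth_onN
    | apply: smooth_onM] => //.
- split; try exact: smooth_form0; apply: smooth_form_row => // i.
  by apply: smooth_onM => //; apply: smooth_on_partial; apply: smooth_on_subset sw.
move=> x Ux i; have Dx := UD _ Ux.
have dw := smooth_on_differentiable sw Dx.
have -> : partial i (fun y => 2 * weyl_factor y) x = 2 * partial i weyl_factor x.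
  by rewrite partialM // partial_cst mulr0 addr0.
have -> : partial i (fun y => - weyl_factor y) x = - partial i weyl_factor x.
  by rewrite /partial -deriveN //; exact: diff_derivable.
rewrite !mxE; have := steady_partial i conformal_steady Ux.
move: (partial i weyl_factor x) (weyl_factor x) => e w z.
have [w0|w0] := eqVneq w 0; first by rewrite (z w0); split; ring.
by split; field.
Qed.

(** W and R differ by a multiple of g wedge g, which only affects Theta; Pi and
    Phi are those of the special SGK condition for R. *)
Lemma nariai_concircular_special_sgk :
  special_super_generalized_recurrent g (concircular g) (ricci_regular g D).
Proof.
set U := ricci_regular g D; have oU : open U := open_ricci_regular.
have UD : U `<=` D by move=> x [[]].
have sD1 := tr_curvature_smooth; have sD2 := angular_curvature_smooth.
have sDw := weyl_factor_smooth; have oD := open_chart.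
have sk1 := smooth_on_subset UD sD1; have sk2 := smooth_on_subset UD sD2.
have sw := smooth_on_subset UD sDw.
have [st1 st2] := ricci_steady.
have st12 : steady_zeros U (fun x => k1 x - k2 x) by move=> x [/tracefree_steady].
have s12 i := ricci_coefficients_smooth i oU UD st1 st2 st12.
have sm i := (s12 i).1; have sl i := (s12 i).2.
have dw i := smooth_on_partial i sw.
exists (fun x => \row_i mean_log_derivative i x).
exists (fun x => \row_i log_derivative_slope i x).
exists (fun x => \row_i
  (2^-1 * (mean_log_derivative i x * weyl_factor x - partial i weyl_factor x)
   - log_derivative_slope i x * (k1 x * k2 x))).
apply: (sgk_block nariai_concircular) => //.
- by split; do ?[exact: sD1 | exact: sD2 | exact: sDw | apply: smooth_onB
    | apply: smooth_onN] => //.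
- split; [| |exact: smooth_form0|]; apply: smooth_form_row => // i;
  by do ?[exact: sk1 | exact: sk2 | exact: sm | exact: sl | exact: sw | exact: dw
    | exact: smooth_on_cst | apply: smooth_onB | apply: smooth_onM] => //.
move=> x Ux i; have Dx := UD _ Ux.
have df1 := smooth_on_differentiable sD1 Dx.
have df2 := smooth_on_differentiable sD2 Dx.
have dfw := smooth_on_differentiable sDw Dx.
have -> : partial i (fun y => - weyl_factor y) x = - partial i weyl_factor x.
  by rewrite /partial -deriveN //; exact: diff_derivable.
rewrite !partialB // !mxE; have [e1 e2] := log_derivative_identities i Ux.
by split; [rewrite [partial i k1 x]e1|rewrite [partial i k2 x]e2| |]; field.
Qed.

End NariaiGeometry.

(** * The charged Nariai type metric *)

Theorem theorem4p1 (R : realType) (r0 L0 : R) (I J : set R) (xi h : R -> R)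
    (r0_gt0 : 0 < r0) (L0_gt0 : 0 < L0) (L0_le1 : L0 <= 1)
    (openI : open I) (openJ : open J)
    (xi_smooth : smooth_on1 I xi) (h_smooth : smooth_on1 J h)
    (xi_neq0 : forall r, I r -> xi r != 0)
    (h_neq0 : forall theta, J theta -> h theta != 0) :
  let g := nariai_metric r0 L0 xi h in
  let D := nariai_chart I J in
  (semisymmetric g D /\ conformally_pseudosymmetric g D) /\
  [/\ two_quasi_einstein g (non_einstein g D),
      generalized_quasi_einstein g D
    & roter_type g (non_einstein g D)] /\
  (special_super_generalized_recurrent g (riemann g) (ricci_regular g D) /\
   super_generalized_recurrent g (projective g) (tracefree_regular g D)) /\
  (recurrent g (conformal g) (conformal_regular g D) /\
   special_super_generalized_recurrent g (concircular g) (ricci_regular g D)) /\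
  (ricci_compatible g (riemann g) D /\ ricci_compatible g (projective g) D).
Proof.
have B0 : r0 ^+ 2 != 0 by rewrite expf_neq0 // gt_eqF.
have A0 : r0 ^+ 2 / L0 != 0 by rewrite mulf_neq0 // invr_neq0 // gt_eqF.
move=> g D; split; [split|split; [split|split; [split|split; [split|split]]]].
- exact: (nariai_semisymmetric A0 B0).
- exact: (nariai_conformally_pseudosymmetric A0 B0).
- exact: (nariai_two_quasi_einstein A0 B0).
- exact: (nariai_generalized_quasi_einstein A0 B0).
- exact: (nariai_roter_type A0 B0).
- exact: (nariai_riemann_special_sgk A0 B0).
- exact: (nariai_projective_sgk A0 B0).
- exact: (nariai_conformal_recurrent A0 B0).
- exact: (nariai_concircular_special_sgk A0 B0).
- exact: (nariai_riemann_compatible A0 B0).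
- exact: (nariai_projective_compatible A0 B0).
Qed.
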